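(* Let $0<\theta<\theta'<\pi$. Then, as $n\to\infty$ with $\theta,\theta'$ fixed, $$M(n,\theta)\le\frac{M(n-1,\theta')}{\lambda_n(\theta,\theta')}\bigl(1+O(ne^{-nc})\bigr),$$ where $c:=\frac12\log\left(\frac{1-r^2}{1-R^2}\right)>0$ is independent of $n$ and depends only on $\theta$ and $\theta'$.
   Context: $S^{n-1}$ is the unit sphere in $\mathbb{R}^n$. A $\theta$-spherical code is a finite subset $A\subset S^{n-1}$ such that no two distinct points of $A$ are at angular distance less than $\theta$; $M(n,\theta)$ is the largest cardinality of a $\theta$-spherical code in $S^{n-1}$. For $0<\theta<\theta'\le\pi$, $\lambda_n(\theta,\theta')$ is the ratio of the volume of the spherical cap of radius $\frac{\sin(\theta/2)}{\sin(\theta'/2)}$ on $S^{n-1}$ to the volume of the whole sphere; here the cap of radius $\rho$ centered at $z\in S^{n-1}$ is $\{a\in S^{n-1}:\langle a,z\rangle\ge\sqrt{1-\rho^2}\}$. Put $s=\cos\theta$, $s'=\cos\theta'$, $r=\sqrt{\frac{s-s'}{1-s'}}$ (equivalently $\sqrt{1-r^2}=\frac{\sin(\theta/2)}{\sin(\theta'/2)}$), $\gamma_{\theta,\theta'}=2\arctan\frac{s}{\sqrt{(1-s)(s-s')}}+\arccos(r)-\pi$, and $R=\cos(\gamma_{\theta,\theta'})$.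
   Formalization: The bound is proved for all 0<θ<θ'<π, but c>0 is asserted only when θ'<π/2 or θ>π/2, exactly where it holds (θ=π/3, θ'=π/2 gives r=R and c=0); when R=±1, c is read as +∞ and e^{-nc} as 0. *)

(* Defs.v *)
From HB Require Import structures.
From mathcomp Require Import all_boot all_order all_algebra finmap.
From mathcomp Require Import all_classical all_reals all_analysis.
Import Order.TTheory GRing.Theory Num.Theory.
Import numFieldNormedType.Exports.

Set Implicit Arguments.
Unset Strict Implicit.
Unset Printing Implicit Defensive.

Local Open Scope classical_set_scope.
Local Open Scope ring_scope.

Section euclidean_space.
Context {R : realType}.

Definition dot {n} (u v : 'rV[R]_n) : R := \sum_(i < n) u 0 i * v 0 i.

(* The canonical norm on row vectors is the sup norm, hence the use of [dot].
   [sphere n] is S^{n-1}. *)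
Definition sphere n : set 'rV[R]_n := [set x | dot x x = 1].
Arguments sphere n _ : clear implicits.

Definition angular_distance {n} (x y : 'rV[R]_n) : R := acos (dot x y).

(* n-dimensional Lebesgue measure, as the iterated product of the measure on R
   (cf. [product_measure1]); to be applied to Borel sets only. *)
Fixpoint lebesgue_volume n : set 'rV[R]_n -> \bar R :=
  match n return set 'rV[R]_n -> \bar R with
  | 0 => fun A => (\1_A (0 : 'rV[R]_0))%:E
  | m.+1 => fun A =>
      (\int[lebesgue_measure]_x
         lebesgue_volume [set v : 'rV[R]_m | A (row_mx x%:M v : 'rV[R]_(1 + m))])%E
  end.

Definition cone n (A : set 'rV[R]_n) : set 'rV[R]_n :=
  [set t *: a | t in `]0, 1] & a in A].

(* Surface measure of A in S^{n-1}: by polar coordinates, n times the volume of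
   the cone over A inside the unit ball. *)
Definition sphere_volume n (A : set 'rV[R]_n) : \bar R :=
  (n%:R%:E * lebesgue_volume (cone A))%E.

Definition spherical_cap n (rho : R) (z : 'rV[R]_n) : set 'rV[R]_n :=
  [set a | sphere n a /\ Num.sqrt (1 - rho ^+ 2) <= dot a z].

End euclidean_space.

Arguments sphere {R} n _.

Section spherical_codes.
Context {R : realType}.
Implicit Types theta : R.

Definition spherical_code n theta (A : {fset 'rV[R]_n}) : Prop :=
  (forall x, x \in A -> sphere n x) /\
  (forall x y, x \in A -> y \in A -> x != y -> theta <= angular_distance x y).

(* For theta > 0 the cardinalities are bounded, by compactness of the sphere,
   so that this supremum of natural numbers is a maximum. *)
Definition max_code_size n theta : R :=
  sup [set #|` A|%:R | A in spherical_code (n := n) theta].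

(* The value does not depend on the center z in [sphere n]. *)
Definition cap_ratio n theta (theta' : R) (z : 'rV[R]_n) : R :=
  fine (sphere_volume (spherical_cap (sin (theta / 2) / sin (theta' / 2)) z)) /
  fine (sphere_volume (sphere n)).

Definition inner_cos theta (theta' : R) : R :=
  let s := cos theta in let s' := cos theta' in
  Num.sqrt ((s - s') / (1 - s')).

Definition strip_angle theta (theta' : R) : R :=
  let s := cos theta in let s' := cos theta' in
  2 * atan (s / Num.sqrt ((1 - s) * (s - s'))) + acos (inner_cos theta theta')
  - pi.

Definition outer_cos theta (theta' : R) : R := cos (strip_angle theta theta').

(* Extended-real valued: [outer_cos] can be 1 or -1, in which case the
   denominator vanishes, the rate is +oo and e^{-nc} = 0. *)
Definition decay_rate theta (theta' : R) : \bar R :=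
  ((2^-1)%:E * lne ((1 - inner_cos theta theta' ^+ 2)%:E /
                    (1 - outer_cos theta theta' ^+ 2)%:E))%E.

Definition exp_decay (c : \bar R) (n : nat) : R :=
  fine (expeR (- (n%:R%:E * c)))%E.

End spherical_codes.

(* Main.v *)
Require Import Defs.
From HB Require Import structures.
From mathcomp Require Import all_boot all_order all_algebra finmap.
From mathcomp Require Import all_classical all_reals all_analysis measurable_realfun.
From mathcomp Require Import ring lra.
Import Order.TTheory GRing.Theory Num.Theory.
Import numFieldNormedType.Exports.

(** Fix a theta-code A and a unit vector x, and write s = cos theta and
    s' = cos theta'. Project orthogonally to x the points a of A in the strip
    r <= <a, x> < hi, and normalise. Two such points, at heights u and v, have
    projections at angular distance at least theta' as soon as

      s <= u v + s' sqrt (1 - u^2) sqrt (1 - v^2),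

    so that, when this holds on the square [r, hi)^2, the strip contains at
    most M(n-1, theta') points of A ([strip_code_size]). Averaging over x gives

      |A| (vol cap_r - vol cap_hi) <= M(n-1, theta') vol S

    ([code_size_strip_le]), where cap_r is the cap whose relative volume is
    lambda_n(theta, theta') and cap_hi is the smaller cap cut out by
    <a, x> >= hi. Finally vol cap_hi / vol cap_r is O(n q^n), with q the ratio
    sqrt (1 - hi^2) / sqrt (1 - r^2) of the two radii
    ([volume_cap_cone_ratio]), which is the claimed error term for hi = R.

    It remains to see that hi = R is allowed. If s' > 0, the right-hand side
    of the displayed inequality is concave in u and in v, so that it suffices
    to check the corners of the square; the corner (r, r) gives an equality,
    and R is the other height with an equality at (r, R), namely
    R = r (s + s' - s s') / (s - s' + s s') ([outer_cosE]). If s' <= 0, the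
    right-hand side is increasing in u and v, and hi = 1 is allowed: the smaller
    cap is a point and there is no error term at all. The closed form for R
    also shows that R^2 - r^2 has the sign of s s', whence the positivity of
    the rate.

    The averaging needs the invariance of the volume under reflections. The
    volume being an iterated integral, its invariance under translations is
    immediate by induction, and any translation-invariant measure is unique up
    to a factor by a computation with Tonelli ([volume_linear_comparison]),
    the factor being 1 since a reflection preserves the unit ball. The same
    argument gives the behaviour under dilations. *)

Set Implicit Arguments.
Unset Strict Implicit.
Unset Printing Implicit Defensive.

Local Open Scope classical_set_scope.
Local Open Scope ring_scope.

(** * Row vectors as a measurable space *)
Section measurable_rows.
Context {R : realType}.

Definition row_display : measure_display. Proof. exact: (default_measure_display). Qed.

(** Generating by coordinates makes a map into row vectors measurable as soon
    as its coordinates are, and makes the sections used by [lebesgue_volume]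
    measurable; this sigma-algebra is the Borel one. *)
Definition coordinate_sets n : set (set 'rV[R]_n) :=
  [set A | exists (i : 'I_n) (B : set R),
     measurable B /\ A = [set v : 'rV[R]_n | B (v 0 i)]].

HB.instance Definition _ n := @isMeasurable.Build row_display 'rV[R]_n
  <<s @coordinate_sets n >> (@sigma_algebra0 _ setT (@coordinate_sets n))
  (@sigma_algebraC _ (@coordinate_sets n))
  (@sigma_algebra_bigcup _ setT (@coordinate_sets n)).

Lemma measurable_coord n (i : 'I_n) :
  measurable_fun setT (fun v : 'rV[R]_n => v 0 i).
Proof.
move=> _ Y mY; rewrite setTI; apply: sub_sigma_algebra.
by exists i, Y.
Qed.

Lemma measurable_row d (T : measurableType d) n (f : T -> 'rV[R]_n) :
  (forall i, measurable_fun setT (fun x => f x 0 i)) -> measurable_fun setT f.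
Proof.
move=> mf; apply: (@measurability _ _ _ _ _ _ (@coordinate_sets n)) => //.
by move=> _ [_ [i [B [mB ->]]]] <-; exact: mf.
Qed.

Lemma measurable_dot d (T : measurableType d) n (f g : T -> 'rV[R]_n) :
  measurable_fun setT f -> measurable_fun setT g ->
  measurable_fun setT (fun x => dot (f x) (g x)).
Proof.
move=> mf mg; apply: measurable_sum => i.
by apply: measurable_funM; exact: (measurableT_comp (measurable_coord i)).
Qed.

Lemma measurable_rowD d (T : measurableType d) n (f g : T -> 'rV[R]_n) :
  measurable_fun setT f -> measurable_fun setT g ->
  measurable_fun setT (fun x => f x + g x).
Proof.
move=> mf mg; apply: measurable_row => i.
under eq_fun do rewrite mxE.
by apply: measurable_funD; exact: (measurableT_comp (measurable_coord i)).
Qed.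

Lemma measurable_rowZ d (T : measurableType d) n (h : T -> R) (f : T -> 'rV[R]_n) :
  measurable_fun setT h -> measurable_fun setT f ->
  measurable_fun setT (fun x => h x *: f x).
Proof.
move=> mh mf; apply: measurable_row => i.
under eq_fun do rewrite mxE.
by apply: measurable_funM => //; exact: (measurableT_comp (measurable_coord i)).
Qed.

Lemma measurable_rowN d (T : measurableType d) n (f : T -> 'rV[R]_n) :
  measurable_fun setT f -> measurable_fun setT (fun x => - f x).
Proof.
move=> mf; apply: measurable_row => i.
under eq_fun do rewrite mxE.
by apply: measurableT_comp => //; exact: (measurableT_comp (measurable_coord i)).
Qed.

Definition cons_row n (x : R) (v : 'rV[R]_n) : 'rV[R]_n.+1 := row_mx x%:M v.

Lemma cons_row0 n x (v : 'rV[R]_n) : cons_row x v 0 0 = x.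
Proof.
rewrite (_ : cons_row x v 0 0 = row_mx x%:M v 0 (lshift n (0 : 'I_1))).
  by rewrite row_mxEl mxE eqxx mulr1n.
by congr (row_mx x%:M v _ _); exact: val_inj.
Qed.

Lemma cons_rowS n x (v : 'rV[R]_n) i : cons_row x v 0 (lift 0 i) = v 0 i.
Proof.
rewrite (_ : cons_row x v 0 (lift 0 i) = row_mx x%:M v 0 (rshift 1 i)).
  by rewrite row_mxEr.
by congr (row_mx x%:M v _ _); exact: val_inj.
Qed.

Lemma measurable_cons_row d (T : measurableType d) n (h : T -> R)
    (f : T -> 'rV[R]_n) :
  measurable_fun setT h -> measurable_fun setT f ->
  measurable_fun setT (fun x => cons_row (h x) (f x)).
Proof.
move=> mh mf; apply: measurable_row => i.
case: (unliftP 0 i) => [j ->|->].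
  under eq_fun do rewrite cons_rowS.
  exact: (measurableT_comp (measurable_coord j)).
by under eq_fun do rewrite cons_row0.
Qed.

End measurable_rows.
(** * The iterated volume is a measure *)
Section sigma_finite_measure_ex.
Context d (T : measurableType d) {R : realType} (m : {measure set T -> \bar R}).
Hypothesis m_sigma_finite : sigma_finite setT m.

(** A name of its own for the measure, on which the sigma-finiteness proof can
    be recorded. *)
Definition measure_copy : set T -> \bar R := m.

HB.instance Definition _ := Measure.on measure_copy.
HB.instance Definition _ :=
  @Measure_isSigmaFinite.Build _ _ _ measure_copy m_sigma_finite.

Lemma sigma_finite_measure_ex :
  exists mu : {sigma_finite_measure set T -> \bar R}, forall A, mu A = m A.
Proof. by exists measure_copy. Qed.

End sigma_finite_measure_ex.

Section lebesgue_volume_measure.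
Context {R : realType}.

Lemma lebesgue_volume_cons n (A : set 'rV[R]_n.+1) :
  lebesgue_volume A =
  (\int[lebesgue_measure]_x lebesgue_volume [set v | A (cons_row x v)])%E.
Proof. by []. Qed.

Lemma measurable_fun_cons_row n :
  measurable_fun setT (fun p : R * 'rV[R]_n => cons_row p.1 p.2).
Proof. exact: measurable_cons_row. Qed.

(** Induction on the dimension: the volume on dimension n+1 is the image, under
    the coordinate bijection [cons_row], of the product of the line with the
    measure found in dimension n. Sigma-finiteness is carried along because
    the product construction requires it of the second factor. *)
Theorem lebesgue_volume_measure n :
  exists mu : {sigma_finite_measure set 'rV[R]_n -> \bar R},
    forall A, measurable A -> mu A = lebesgue_volume A.
Proof.
elim: n => [|n [mu muE]].
  exists (\d_(0 : 'rV[R]_0)) => A mA /=.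
  by rewrite diracE indicE.
pose f (p : R * 'rV[R]_n) := cons_row p.1 p.2.
have mf : measurable_fun setT f := @measurable_fun_cons_row n.
pose nu := pushforward (lebesgue_measure \x mu)%E f.
have nuE A : nu A =
    (\int[lebesgue_measure]_x mu [set v | A (cons_row x v)])%E.
  apply: eq_integral => x _ /=; congr (mu _).
  by apply/seteqP; split => v /=; rewrite /xsection/= inE.
have sf : sigma_finite setT nu.
  have /sigma_finiteP[F [TF ndF Foo]] := sigma_finiteT (@lebesgue_measure R).
  have /sigma_finiteP[G [TG ndG Goo]] := sigma_finiteT mu.
  pose g (w : 'rV[R]_n.+1) : R * 'rV[R]_n := (w 0 0, \row_i w 0 (lift 0 i)).
  have mg : measurable_fun setT g.
    apply: measurable_fun_pair => /=; first exact: measurable_coord.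
    apply: measurable_row => i; under eq_fun do rewrite mxE.
    exact: measurable_coord.
  have gf p : g (f p) = p.
    rewrite /g /f cons_row0; case: p => x v /=; congr pair.
    by apply/rowP => i; rewrite mxE cons_rowS.
  (* the increasing covers F of the line and G of the rows give a cover of the
     product by boxes of finite measure *)
  exists (fun k => g @^-1` (F k `*` G k)).
    apply/esym/seteqP; split => // w _.
    have [k _ Fk] : (\bigcup_i F i) (g w).1 by rewrite -TF.
    have [l _ Gl] : (\bigcup_i G i) (g w).2 by rewrite -TG.
    exists (maxn k l) => //; split => /=.
    - by move: Fk; apply/subsetPset/ndF/leq_maxl.
    - by move: Gl; apply/subsetPset/ndG/leq_maxr.
  move=> k; have [mFk Fkoo] := Foo k; have [mGk Gkoo] := Goo k; split.
    by rewrite -[X in measurable X]setTI; apply: mg => //; exact: measurableX.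
  rewrite (_ : nu _ = (lebesgue_measure \x mu)%E (F k `*` G k)).
    by rewrite product_measure1E// lte_mul_pinfty// ge0_fin_numE.
  rewrite /nu /pushforward; congr (_ _).
  by rewrite -comp_preimage (_ : g \o f = id)//; exact/funext.
have [mu' mu'E] := sigma_finite_measure_ex (m := pushforward (lebesgue_measure \x mu)%E f) sf.
exists mu' => A mA; rewrite mu'E [LHS]nuE lebesgue_volume_cons.
apply: eq_integral => x _; rewrite muE//.
rewrite -[X in measurable X]setTI.
by apply: (measurable_cons_row (measurable_cst x) (@measurable_id _ _ setT)).
Qed.

End lebesgue_volume_measure.
(** * Invariance properties of the volume *)
Section volume.
Context {R : realType}.

Definition volume n : {sigma_finite_measure set 'rV[R]_n -> \bar R} :=
  projT1 (cid (lebesgue_volume_measure n)).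

Lemma volumeE n (A : set 'rV[R]_n) : measurable A -> volume n A = lebesgue_volume A.
Proof. exact: projT2 (cid (lebesgue_volume_measure n)) A. Qed.

Lemma measurable_preimage d d' (T : measurableType d) (U : measurableType d')
    (f : T -> U) (A : set U) :
  measurable_fun setT f -> measurable A -> measurable [set x | A (f x)].
Proof. by move=> mf mA; rewrite -[X in measurable X]setTI; exact: mf. Qed.

Lemma measurable_section n (A : set 'rV[R]_n.+1) x :
  measurable A -> measurable [set v | A (cons_row x v)].
Proof.
apply: measurable_preimage.
exact: (measurable_cons_row (measurable_cst x) (@measurable_id _ _ setT)).
Qed.

Lemma volume_cons n (A : set 'rV[R]_n.+1) : measurable A ->
  volume n.+1 A =
  (\int[lebesgue_measure]_x volume n [set v | A (cons_row x v)])%E.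
Proof.
move=> mA; rewrite volumeE// lebesgue_volume_cons; apply: eq_integral => x _.
by rewrite volumeE//; exact: measurable_section.
Qed.

Lemma measurable_fun_volume_section n (A : set 'rV[R]_n.+1) : measurable A ->
  measurable_fun setT (fun x : R => volume n [set v | A (cons_row x v)]).
Proof.
move=> mA.
have mB : measurable [set p : R * 'rV[R]_n | A (cons_row p.1 p.2)].
  exact: (measurable_preimage (@measurable_fun_cons_row R n)).
have := measurable_fun_xsection (volume n) mB.
apply: eq_measurable_fun => x _ /=; congr (volume _ _).
by apply/seteqP; split => v; rewrite /xsection/= inE.
Qed.

(** The shifted measure gives the same length to each half-open interval,
    which determines the measure. *)
Lemma lebesgue_measure_shift (c : R) (A : set R) : measurable A ->
  pushforward lebesgue_measure ((fun x => x + c) : _ -> measurableTypeR R) A =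
  lebesgue_measure A.
Proof.
move=> mA; apply/esym/lebesgue_measure_unique => //=.
  by apply: measurable_funD.
move=> ms _ [[a b]] _ <-.
rewrite /pushforward.
rewrite (_ : _ @^-1` _ = `](a - c), (b - c)]%classic); last first.
  by apply/seteqP; split => x /=; rewrite !in_itv/= ltrBlDr lerBrDr.
by rewrite !lebesgue_measure_itv/= !lte_fin ltrD2r; case: ifPn => // _;
  rewrite -!EFinD; congr (_%:E); lra.
Qed.

Lemma ge0_integral_shift (c : R) (f : R -> \bar R) :
  measurable_fun setT f -> (forall x, 0 <= f x)%E ->
  (\int[lebesgue_measure]_x f (x + c)%R = \int[lebesgue_measure]_x f x)%E.
Proof.
move=> mf f0.
have ms : measurable_fun setT ((fun x => x + c) : R -> measurableTypeR R).
  exact: measurable_funD.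
transitivity (\int[pushforward lebesgue_measure
    ((fun x => x + c)%R : _ -> measurableTypeR R)]_x f x)%E.
  by rewrite ge0_integral_pushforward.
apply: eq_measure_integral => A mA _; exact: lebesgue_measure_shift.
Qed.

Lemma measurable_fun_shift n (c : 'rV[R]_n) :
  measurable_fun setT (fun v : 'rV[R]_n => v + c).
Proof. exact: measurable_rowD. Qed.

(** One coordinate at a time: the outer integral absorbs the shift of the first
    coordinate, the induction hypothesis that of the others. *)
Lemma volume_shift n (A : set 'rV[R]_n) (c : 'rV[R]_n) : measurable A ->
  volume n [set v | A (v + c)] = volume n A.
Proof.
elim: n A c => [|n IHn] A c mA.
  by congr (volume _ _); apply/seteqP; split => v /=; rewrite [v + c]thinmx0 [v]thinmx0.
rewrite !volume_cons//; last first.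
  exact: (measurable_preimage (measurable_fun_shift c)).
rewrite -[RHS](ge0_integral_shift (c 0 0))//; last exact: measurable_fun_volume_section.
apply: eq_integral => x _.
rewrite -[RHS](IHn _ (\row_i c 0 (lift 0 i))); last exact: measurable_section.
congr (volume _ _); apply: eq_set => v; congr (A _); apply/rowP => i.
by rewrite mxE; case: (unliftP 0 i) => [j ->|->];
  rewrite ?cons_rowS ?cons_row0// !mxE.
Qed.

Definition tail_row n (w : 'rV[R]_n.+1) : 'rV[R]_n := \row_i w 0 (lift 0 i).

Lemma cons_rowK n x (v : 'rV[R]_n) : tail_row (cons_row x v) = v.
Proof. by apply/rowP => i; rewrite mxE cons_rowS. Qed.

Lemma measurable_tail_row n : measurable_fun setT (@tail_row n).
Proof.
apply: measurable_row => i; under eq_fun do rewrite mxE.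
exact: measurable_coord.
Qed.

Lemma measurable_cylinder n (a b : R) (C : set 'rV[R]_n) : measurable C ->
  measurable [set w : 'rV[R]_n.+1 | a <= w 0 0 <= b /\ C (tail_row w)].
Proof.
move=> mC.
rewrite (_ : mkset _ = [set w : 'rV[R]_n.+1 | w 0 0 \in `[a, b]] `&`
    [set w | C (tail_row w)]); last first.
  by apply/seteqP; split => w /=; rewrite in_itv.
apply: measurableI.
  apply: (measurable_preimage (A := `[a, b]%classic)); last exact: measurable_itv.
  exact: measurable_coord.
by apply: measurable_preimage => //; exact: measurable_tail_row.
Qed.

Lemma volume_cylinder n (a b : R) (C : set 'rV[R]_n) : a <= b -> measurable C ->
  volume n.+1 [set w : 'rV[R]_n.+1 | a <= w 0 0 <= b /\ C (tail_row w)] =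
  ((b - a)%:E * volume n C)%E.
Proof.
move=> ab mC.
have mS := measurable_cylinder a b mC.
rewrite volume_cons//.
under eq_integral => x _.
  rewrite (_ : volume n _ = volume n C * (\1_(`[a, b]%classic) x)%:E)%E; last first.
    rewrite indicE mem_setE in_itv/=; case: (boolP (a <= x <= b)) => xab.
      rewrite mule1; congr (volume _ _).
      by apply/seteqP; split => v /=; rewrite cons_row0 cons_rowK// => -[].
    rewrite mule0 -(measure0 (volume n)); congr (volume _ _).
    by apply/seteqP; split => v //= []; rewrite cons_row0 (negPf xab).
  over.
rewrite ge0_integralZl//.
- rewrite integral_indic//= setIT.
  by rewrite lebesgue_measure_itv/= lte_fin muleC; case: ltgtP ab => // <-; rewrite subrr mul0e.
- by apply/measurable_EFinP; exact: measurable_indic.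
Qed.

Definition cube n (rho : R) : set 'rV[R]_n := [set v | forall i, `|v 0 i| <= rho].
Arguments cube : clear implicits.

Lemma measurable_cube n rho : measurable (cube n rho).
Proof.
rewrite (_ : cube n rho = \big[setI/setT]_(i < n) [set v : 'rV[R]_n | v 0 i \in `[- rho, rho]]).
  apply: bigsetI_measurable => i _.
  by apply: (measurable_preimage (A := `[- rho, rho]%classic)) => //; exact: measurable_coord.
rewrite -bigcap_seq; apply/seteqP; split => v h i.
  by move=> _; rewrite /= in_itv/= -ler_norml; exact: h.
by have := h i (mem_index_enum i); rewrite /= in_itv/= -ler_norml.
Qed.

(** Cubes are the sets of explicitly known volume: they calibrate the scaling
    law and show that balls have finite positive volume. *)
Lemma volume_cube n rho : 0 <= rho -> volume n (cube n rho) = ((2 * rho) ^+ n)%:E.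
Proof.
move=> rho0; elim: n => [|n IHn].
  rewrite volumeE ?expr0; last exact: measurable_cube.
  by rewrite /= indicE mem_set// => -[].
rewrite (_ : cube n.+1 rho = [set w : 'rV[R]_n.+1 | - rho <= w 0 0 <= rho /\
    cube n rho (tail_row w)]).
  rewrite volume_cylinder ?ge0_cp//; last exact: measurable_cube.
  by rewrite IHn exprS -EFinM; congr (_ * _)%:E; lra.
apply/seteqP; split => w /=.
  by move=> h; rewrite -ler_norml; split => // i; rewrite mxE.
by case; rewrite -ler_norml => h0 h i; case: (unliftP 0 i) => [j ->|->]//; have := h j; rewrite mxE.
Qed.

(** The classical uniqueness argument for translation-invariant measures: for
    an additive surjection [T], the measures A |-> vol A and A |-> vol (T^-1 A)
    are proportional, which one reads off by computing in two ways, with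
    Tonelli, the measure of a set of pairs. Taking for [B] a symmetric set
    whose preimage has a known volume identifies the factor: a cube for
    dilations, a ball for isometries. *)
Theorem volume_linear_comparison n (T U : 'rV[R]_n -> 'rV[R]_n)
    (A B : set 'rV[R]_n) :
  measurable_fun setT T -> {morph T : x y / x + y} -> cancel U T ->
  measurable A -> measurable B -> (forall x, B (- x) -> B x) ->
  (volume n [set x | A (T x)] * volume n B =
   volume n A * volume n [set x | B (T x)])%E.
Proof.
move=> mT TD UK mA mB Bsym.
have mTA : measurable [set x | A (T x)] by exact: measurable_preimage.
have mTB : measurable [set x | B (T x)] by exact: measurable_preimage.
(* E1 and E2 are exchanged by (x, y) |-> (x + T y, y), a translation on each
   horizontal slice; their nonempty vertical slices are translates of the
   preimages of A and of B, the latter by symmetry of B. *)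
pose E1 := [set p : 'rV[R]_n * 'rV[R]_n | B p.1 /\ A (p.1 + T p.2)].
pose E2 := [set p : 'rV[R]_n * 'rV[R]_n | A p.1 /\ B (p.1 - T p.2)].
have mTsnd : measurable_fun setT (fun p : 'rV[R]_n * 'rV[R]_n => T p.2).
  exact: measurableT_comp.
have mE1 : measurable E1.
  apply: measurableI; first exact: (measurable_preimage measurable_fst).
  apply: (measurable_preimage (f := fun p : 'rV[R]_n * 'rV[R]_n => p.1 + T p.2)) => //.
  exact: measurable_rowD.
have mE2 : measurable E2.
  apply: measurableI; first exact: (measurable_preimage measurable_fst).
  apply: (measurable_preimage (f := fun p : 'rV[R]_n * 'rV[R]_n => p.1 - T p.2)) => //.
  by apply: measurable_rowD => //; exact: measurable_rowN.
have swap (E : set ('rV[R]_n * 'rV[R]_n)) : measurable E ->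
    (\int[volume n]_x volume n (xsection E x) =
     \int[volume n]_y volume n (ysection E y))%E.
  move=> mE; have := @product_measure_unique _ _ _ _ R (volume n) (volume n)
    (volume n \x^ volume n)%E _ E mE; apply.
  by move=> ? ? ? ? /=; rewrite product_measure2E.
have E12 y : volume n (ysection E1 y) = volume n (ysection E2 y).
  have mE2y : measurable (ysection E2 y) by exact: measurable_ysection.
  rewrite -(volume_shift (T y) mE2y); congr (volume _ _).
  apply/seteqP; split => x /=; rewrite /ysection/= !inE /E1 /E2/= addrK; tauto.
have I1 : (\int[volume n]_x volume n (xsection E1 x) =
           volume n [set x | A (T x)] * volume n B)%E.
  rewrite -[in volume n B](setIT B) -integral_indic// -ge0_integralZl//;
    last by apply/measurable_EFinP; exact: measurable_indic.
  apply: eq_integral => x _; rewrite indicE; have [Bx|Bx] := pselect (B x).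
    rewrite mem_set// mule1 -(volume_shift (U x) mTA); congr (volume _ _).
    apply/seteqP; split => y /=; rewrite /xsection/= inE /E1/= TD UK addrC => //.
    by case.
  rewrite memNset// mule0 -(measure0 (volume n)); congr (volume _ _).
  by apply/seteqP; split => y //=; rewrite /xsection/= inE => -[].
have I2 : (\int[volume n]_x volume n (xsection E2 x) =
           volume n A * volume n [set x | B (T x)])%E.
  rewrite muleC -[in volume n A](setIT A) -integral_indic// -ge0_integralZl//;
    last by apply/measurable_EFinP; exact: measurable_indic.
  apply: eq_integral => x _; rewrite indicE; have [Ax|Ax] := pselect (A x).
    rewrite mem_set// mule1 -(volume_shift (- U x) mTB); congr (volume _ _).
    have T0 : T 0 = 0 by apply: (addrI (T 0)); rewrite -TD !addr0.
    have TN z : T (- z) = - T z by apply: (addrI (T z)); rewrite -TD !subrr.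
    apply/seteqP; split => y /=; rewrite /xsection/= inE /E2/= TD TN UK.
      by case=> _ ?; apply: Bsym; rewrite opprB.
    by move=> ?; split => //; apply: Bsym; rewrite opprB.
  rewrite memNset// mule0 -(measure0 (volume n)); congr (volume _ _).
  by apply/seteqP; split => y //=; rewrite /xsection/= inE => -[].
rewrite -I1 -I2 swap// swap//; exact: eq_integral.
Qed.

End volume.
Arguments cube {R} n rho.
Arguments volume {R} n.
(** * Inner product and reflections *)
Section dot_theory.
Context {R : realType}.
Implicit Types n : nat.

Lemma dotC n (u v : 'rV[R]_n) : dot u v = dot v u.
Proof. by apply: eq_bigr => i _; rewrite mulrC. Qed.

Lemma dotDl n (u v w : 'rV[R]_n) : dot (u + v) w = dot u w + dot v w.
Proof. by rewrite -big_split; apply: eq_bigr => i _; rewrite mxE mulrDl. Qed.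

Lemma dotZl n k (u w : 'rV[R]_n) : dot (k *: u) w = k * dot u w.
Proof. by rewrite [RHS]mulr_sumr; apply: eq_bigr => i _; rewrite mxE mulrA. Qed.

Lemma dotNl n (u w : 'rV[R]_n) : dot (- u) w = - dot u w.
Proof. by rewrite -scaleN1r dotZl mulN1r. Qed.

Lemma dotDr n (u v w : 'rV[R]_n) : dot u (v + w) = dot u v + dot u w.
Proof. by rewrite dotC dotDl !(dotC u). Qed.

Lemma dotZr n k (u w : 'rV[R]_n) : dot u (k *: w) = k * dot u w.
Proof. by rewrite dotC dotZl dotC. Qed.

Lemma dotNr n (u w : 'rV[R]_n) : dot u (- w) = - dot u w.
Proof. by rewrite dotC dotNl dotC. Qed.

Lemma dot0l n (w : 'rV[R]_n) : dot 0 w = 0.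
Proof. by rewrite -(scale0r w) dotZl mul0r. Qed.

Lemma dot0r n (w : 'rV[R]_n) : dot w 0 = 0.
Proof. by rewrite dotC dot0l. Qed.

Definition dotE := (dotDl, dotDr, dotZl, dotZr, dotNl, dotNr, dot0l, dot0r).

Lemma dot_ge0 n (u : 'rV[R]_n) : 0 <= dot u u.
Proof. by apply: sumr_ge0 => i _; rewrite -expr2 sqr_ge0. Qed.

Lemma dot_eq0 n (u : 'rV[R]_n) : dot u u = 0 -> u = 0.
Proof.
move=> /psumr_eq0P u0; apply/rowP => i; rewrite mxE.
by apply/eqP; rewrite -sqrf_eq0 expr2 u0// => j _; rewrite -expr2 sqr_ge0.
Qed.

Lemma cauchy_schwarz n (u v : 'rV[R]_n) : dot u v ^+ 2 <= dot u u * dot v v.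
Proof.
have [v0|v_neq0] := eqVneq (dot v v) 0.
  by rewrite (dot_eq0 v0) !dot0r mulr0 expr0n.
have v_gt0 : 0 < dot v v by rewrite lt_neqAle eq_sym v_neq0 dot_ge0.
have := dot_ge0 (dot v v *: u - dot u v *: v).
rewrite !dotE (dotC v u) => h.
have {}h : 0 <= dot v v * (dot u u * dot v v - dot u v ^+ 2).
  by apply: le_trans h _; rewrite le_eqVlt; apply/orP; left; apply/eqP; ring.
by rewrite pmulr_rge0// subr_ge0 in h.
Qed.

Lemma dot_cons n (u v : 'rV[R]_n.+1) :
  dot u v = u 0 0 * v 0 0 + dot (tail_row u) (tail_row v).
Proof.
by rewrite /dot big_ord_recl; congr (_ + _); apply: eq_bigr => i _; rewrite !mxE.
Qed.

Lemma coord_le_dot n (u : 'rV[R]_n) i : (u 0 i) ^+ 2 <= dot u u.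
Proof.
rewrite /dot (bigD1 i)//= -expr2 lerDl; apply: sumr_ge0 => j _.
by rewrite -expr2 sqr_ge0.
Qed.

(** The Householder reflection in the hyperplane orthogonal to [w]; it is the
    identity for [w = 0], since then the quotient is 0. *)
Definition reflect n (w y : 'rV[R]_n) : 'rV[R]_n :=
  y - (2 * dot y w / dot w w) *: w.

Lemma reflectD n (w : 'rV[R]_n) : {morph reflect w : x y / x + y}.
Proof.
move=> x y; rewrite /reflect dotDl mulrDr mulrDl scalerDl opprD.
by rewrite addrACA.
Qed.

Lemma dot_reflectl n (w x y : 'rV[R]_n) :
  dot (reflect w x) y = dot x (reflect w y).
Proof. by rewrite /reflect !dotE (dotC w y); ring. Qed.

Lemma reflectK n (w : 'rV[R]_n) : involutive (reflect w).
Proof.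
move=> x; have [w0|w0] := eqVneq (dot w w) 0.
  by rewrite /reflect w0 invr0 !mulr0 !scale0r !subr0.
rewrite /reflect !dotE -addrA -opprD -scalerDl.
rewrite [X in X *: w](_ : _ = 0) ?scale0r ?subr0//.
by field.
Qed.

Lemma dot_reflect n (w x : 'rV[R]_n) : dot (reflect w x) (reflect w x) = dot x x.
Proof. by rewrite dot_reflectl reflectK. Qed.

(** Any two vectors of equal norm are exchanged by a reflection, so that
    reflections are the only isometries needed in the sequel. *)
Lemma reflect_swap n (a z : 'rV[R]_n) : dot a a = dot z z ->
  reflect (a - z) z = a.
Proof.
move=> az; have [w0|w0] := eqVneq (dot (a - z) (a - z)) 0.
  by rewrite /reflect w0 invr0 mulr0 scale0r subr0; apply/esym/subr0_eq/dot_eq0.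
rewrite /reflect [X in X *: _](_ : _ = -1); last first.
  by apply: (mulIf w0); rewrite mulfVK// !dotE az (dotC z a); ring.
by rewrite scaleN1r opprK addrC subrK.
Qed.

Lemma measurable_reflect n (w : 'rV[R]_n) : measurable_fun setT (reflect w).
Proof.
apply: measurable_rowD => //; apply: measurable_rowN.
apply: measurable_rowZ => //; apply: measurable_funM => //.
by apply: measurable_funM => //; exact: measurable_dot.
Qed.

End dot_theory.

(** * Volumes of balls and of cones over caps *)
Section ball.
Context {R : realType}.

Lemma measurable_le d (T : measurableType d) (f g : T -> R) :
  measurable_fun setT f -> measurable_fun setT g ->
  measurable [set x | f x <= g x].
Proof.
move=> mf mg; rewrite (_ : mkset _ = [set x | `[0, +oo[%classic (g x - f x)]).
  by apply: measurable_preimage => //; exact: measurable_funB.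
by apply/seteqP; split => x /=; rewrite in_itv/= andbT subr_ge0.
Qed.

Lemma measurable_lt d (T : measurableType d) (f g : T -> R) :
  measurable_fun setT f -> measurable_fun setT g ->
  measurable [set x | f x < g x].
Proof.
move=> mf mg; rewrite (_ : mkset _ = ~` [set x | g x <= f x]).
  by apply: measurableC; exact: measurable_le.
by apply/seteqP; split => x /=; rewrite ltNge; move/negP.
Qed.

Lemma mule_cancelr (b x y : \bar R) :
  b \is a fin_num -> b != 0%E -> (x * b = y * b)%E -> x = y.
Proof.
case: b => [b||]// _; rewrite eqe => b0 /(congr1 (fun z => z * b^-1%:E)%E).
by rewrite -!muleA -EFinM mulfV// !mule1.
Qed.

(** The comparison theorem with a cube as the symmetric set. *)
Lemma volume_scale n (A : set 'rV[R]_n) (t : R) : 0 < t -> measurable A ->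
  volume n [set x | A (t^-1 *: x)] = ((t ^+ n)%:E * volume n A)%E.
Proof.
move=> t0 mA.
have mT : measurable_fun setT (fun x : 'rV[R]_n => t^-1 *: x).
  by apply: measurable_rowZ.
have UK : cancel (fun x : 'rV[R]_n => t *: x) (fun x => t^-1 *: x).
  by apply: scalerK; rewrite gt_eqF.
have sym (x : 'rV[R]_n) : cube n 1 (- x) -> cube n 1 x.
  by move=> h i; have := h i; rewrite mxE normrN.
have := volume_linear_comparison mT (scalerDr _) UK mA (@measurable_cube R n 1) sym.
rewrite (_ : [set x | cube n 1 (t^-1 *: x)] = cube n t); last first.
  apply/seteqP; split => x h i; have := h i;
    by rewrite mxE normrM gtr0_norm ?invr_gt0// ler_pdivrMl// mulr1.
rewrite !volume_cube// ?ltW// mulr1 exprMn EFinM (muleC (2 ^+ n)%:E) muleA (muleC (t ^+ n)%:E).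
have c0 : 2 ^+ n != 0 :> R by rewrite expf_neq0.
exact: mule_cancelr.
Qed.

Definition eball n (rho : R) : set 'rV[R]_n := [set y | dot y y <= rho ^+ 2].
Arguments eball : clear implicits.

Lemma measurable_eball n rho : measurable (eball n rho).
Proof. by apply: measurable_le => //; exact: measurable_dot. Qed.

Lemma eball_sub_cube n rho : 0 <= rho -> eball n rho `<=` cube n rho.
Proof.
move=> rho0 y yrho i; rewrite -(ger0_norm rho0) -ler_sqr// !real_normK ?num_real//.
exact: le_trans (coord_le_dot _ _) yrho.
Qed.

Lemma volume_eball_fin n : volume n (eball n 1) \is a fin_num.
Proof.
rewrite ge0_fin_numE//; apply: le_lt_trans (_ : volume n (cube n 1) < _)%E.
  apply: le_measure; rewrite ?inE.
  - exact: measurable_eball.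
  - exact: measurable_cube.
  - exact: eball_sub_cube.
by rewrite volume_cube// ltry.
Qed.

Lemma volume_eball_gt0 n : (0 < volume n (eball n 1))%E.
Proof.
apply: lt_le_trans (_ : volume n (cube n n.+1%:R^-1) <= _)%E.
  by rewrite volume_cube// lte_fin exprn_gt0// mulr_gt0// invr_gt0.
apply: le_measure; rewrite ?inE; [exact: measurable_cube|exact: measurable_eball|].
move=> y yc; rewrite /eball/= expr1n.
apply: (@le_trans _ _ (\sum_(i < n) n.+1%:R^-1)).
  apply: ler_sum => i _; rewrite -expr2 -real_normK ?num_real//.
  apply: (@le_trans _ _ (n.+1%:R^-1 ^+ 2)); first by rewrite ler_sqr// nnegrE.
  by rewrite expr2 ler_piMr// invf_le1// ler1n.
by rewrite sumr_const card_ord -[leLHS]mulr_natr ler_pdivrMl// mulr1 ler_nat.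
Qed.

(** The radius may be 0 here, which is the case needed for the degenerate cap
    of radius 0; there the ball is compared with a degenerate cube. *)
Lemma volume_eball_le n rho : 0 <= rho ->
  (volume n.+1 (eball n.+1 rho) <= (rho ^+ n.+1)%:E * volume n.+1 (eball n.+1 1))%E.
Proof.
rewrite le_eqVlt => /predU1P[<-|rho0].
  rewrite exprS mul0r mul0e; apply: le_trans (_ : volume n.+1 (cube n.+1 0) <= _)%E.
    apply: le_measure; rewrite ?inE.
    - exact: measurable_eball.
    - exact: measurable_cube.
    - exact: eball_sub_cube.
  by rewrite volume_cube// mulr0 exprS mul0r.
rewrite -volume_scale//; last exact: measurable_eball.
rewrite le_eqVlt; apply/orP; left; apply/eqP; congr (volume _ _).
apply/seteqP; split => y; rewrite /eball/= !dotE expr1n mulrA -expr2 exprVn;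
  by rewrite ler_pdivrMl ?mulr1// exprn_gt0.
Qed.

Lemma volume_eball n rho : 0 < rho ->
  volume n (eball n rho) = ((rho ^+ n)%:E * volume n (eball n 1))%E.
Proof.
move=> rho0; rewrite -volume_scale//; last exact: measurable_eball.
congr (volume _ _).
apply/seteqP; split => y; rewrite /eball/= !dotE expr1n mulrA -expr2 exprVn;
  by rewrite ler_pdivrMl ?mulr1// exprn_gt0.
Qed.

(** The comparison theorem with the unit ball as the symmetric set: a reflection
    maps the ball to itself. *)
Lemma volume_reflect n (w : 'rV[R]_n) (A : set 'rV[R]_n) : measurable A ->
  volume n [set x | A (reflect w x)] = volume n A.
Proof.
move=> mA.
have sym (x : 'rV[R]_n) : eball n 1 (- x) -> eball n 1 x.
  by rewrite /eball/= !dotE opprK.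
have := volume_linear_comparison (measurable_reflect w) (reflectD w)
  (reflectK w) mA (@measurable_eball n 1) sym.
rewrite (_ : [set x | eball n 1 (reflect w x)] = eball n 1); last first.
  by apply: eq_set => x; rewrite /eball/= dot_reflect.
by apply: mule_cancelr; rewrite ?volume_eball_fin// gt_eqF// volume_eball_gt0.
Qed.

(** The cone inside the unit ball over the cap with centre [z] whose points have
    inner product at least [r] with [z], for [0 <= r]: this is the condition
    r |y| <= <y, z>, squared so as to be polynomial. *)
Definition cap_cone n (r : R) (z : 'rV[R]_n) : set 'rV[R]_n :=
  [set y | 0 < dot y y <= 1 /\ 0 <= dot y z /\ r ^+ 2 * dot y y <= dot y z ^+ 2].

Lemma measurable_cap_cone n r (z : 'rV[R]_n) : measurable (cap_cone r z).
Proof.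
have mdd : measurable_fun setT (fun y : 'rV[R]_n => dot y y) by exact: measurable_dot.
have mdz : measurable_fun setT (fun y : 'rV[R]_n => dot y z) by exact: measurable_dot.
rewrite (_ : cap_cone r z = [set y | 0 < dot y y] `&` [set y | dot y y <= 1] `&`
  ([set y | 0 <= dot y z] `&` [set y | r ^+ 2 * dot y y <= dot y z ^+ 2])).
  apply: measurableI; apply: measurableI.
  - exact: measurable_lt.
  - exact: measurable_le.
  - exact: measurable_le.
  - by apply: measurable_le; [exact: measurable_funM|exact: measurable_funX].
apply/seteqP; split => y /=.
  by move=> [/andP[? ?] [? ?]].
by move=> [[y0 y1] [? ?]]; split => //; apply/andP.
Qed.

Lemma volume_cap_cone_center n r (a z : 'rV[R]_n) : dot a a = dot z z ->
  volume n (cap_cone r a) = volume n (cap_cone r z).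
Proof.
move=> az; rewrite -(volume_reflect (a - z) (@measurable_cap_cone n r z)).
congr (volume _ _); apply: eq_set => y.
by rewrite /cap_cone/= dot_reflect dot_reflectl reflect_swap.
Qed.

Definition pole n : 'rV[R]_n.+1 := cons_row 1 0.

Lemma dot_pole n (y : 'rV[R]_n.+1) : dot y (pole n) = y 0 0.
Proof. by rewrite dot_cons cons_row0 cons_rowK dot0r mulr1 addr0. Qed.

Lemma dot_pole_pole n : dot (pole n) (pole n) = 1.
Proof. by rewrite dot_pole cons_row0. Qed.

(** The cone lies in a cylinder of height 1 along its axis, whose base has the
    radius sqrt (1 - r^2) of the cap. *)
Lemma volume_cap_cone_ub n r : 0 <= r <= 1 ->
  (volume n.+2 (cap_cone r (pole n.+1)) <=
   (Num.sqrt (1 - r ^+ 2) ^+ n.+1)%:E * volume n.+1 (eball n.+1 1))%E.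
Proof.
move=> /andP[r0 r1]; set rho := Num.sqrt _.
have rho2 : rho ^+ 2 = 1 - r ^+ 2.
  by rewrite sqr_sqrtr// subr_ge0 expr_le1.
have rho0 : 0 <= rho by exact: sqrtr_ge0.
apply: le_trans (volume_eball_le _ rho0).
rewrite -[leRHS]mul1e -(subr0 1) -volume_cylinder//; last exact: measurable_eball.
apply: le_measure; rewrite ?inE.
- exact: measurable_cap_cone.
- by apply: measurable_cylinder; exact: measurable_eball.
move=> y [/andP[y0 y1]]; rewrite dot_pole => -[y00 h].
have := dot_cons y y; rewrite -expr2 => yE.
have := dot_ge0 (tail_row y) => t0.
split.
  rewrite y00/= -(@expr_le1 _ 2)//; lra.
rewrite /eball/= rho2; nra.
Qed.

Lemma bernoulli_ineq n (h : R) : 0 <= h <= 1 -> 1 - n%:R * h <= (1 - h) ^+ n.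
Proof.
move=> /andP[h0 h1]; elim: n => [|n IHn]; first by rewrite mul0r subr0.
rewrite exprS.
have : (1 - h) * (1 - n%:R * h) <= (1 - h) * (1 - h) ^+ n.
  by rewrite ler_wpM2l// subr_ge0.
apply: le_trans; rewrite -natr1.
have : 0 <= n%:R * h ^+ 2 by rewrite mulr_ge0// sqr_ge0.
nra.
Qed.

(** The cone contains the cylinder over the heights between r (1 - h) and r,
    with a base radius smaller by the factor 1 - h than that of the cap. A
    height of order 1/n costs only a constant factor in the volume of the base,
    by the Bernoulli inequality; hence the factor n in the error term of the
    theorem. *)
Lemma volume_cap_cone_lb n r : 0 < r < 1 ->
  ((r / (4 * n.+1%:R) * Num.sqrt (1 - r ^+ 2) ^+ n)%:E * volume n (eball n 1) <=
   volume n.+1 (cap_cone r (pole n)))%E.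
Proof.
move=> /andP[r0 r1]; set rho := Num.sqrt _.
have rho2 : rho ^+ 2 = 1 - r ^+ 2.
  by rewrite sqr_sqrtr// subr_ge0 expr_le1// ltW.
have rho0 : 0 < rho by rewrite sqrtr_gt0 subr_gt0 expr_lt1// ltW.
(* with this height, (1 - h)^n >= 1 - n h >= 1/2 *)
pose h : R := (2 * n.+1%:R)^-1.
have h0 : 0 < h by rewrite invr_gt0 mulr_gt0.
have h1 : h <= 1 / 2.
  by rewrite /h invfM mul1r ler_piMr// invf_le1// ler1n.
have bern : 1 / 2 <= (1 - h) ^+ n.
  apply: le_trans (bernoulli_ineq n _); last by rewrite ltW//=; lra.
  have : n%:R * h <= 1 / 2; last lra.
  rewrite /h invfM mulrCA mul1r ler_piMr// ler_pdivrMr// mul1r.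
  by rewrite ler_nat.
apply: (@le_trans _ _ (volume n.+1 [set w : 'rV[R]_n.+1 | r * (1 - h) <= w 0 0 <= r /\
    eball n ((1 - h) * rho) (tail_row w)])).
  rewrite volume_cylinder; last 2 first.
  - by nra.
  - exact: measurable_eball.
  rewrite [leRHS](_ : _ = ((r - r * (1 - h))%:E *
      (((1 - h) * rho) ^+ n)%:E * volume n (eball n 1))%E); last first.
    rewrite -muleA -volume_eball//.
    by rewrite mulr_gt0//; lra.
  rewrite -EFinM; apply: lee_pmul => //.
    by rewrite lee_fin mulr_ge0 ?exprn_ge0 ?ltW// divr_gt0// mulr_gt0.
  rewrite lee_fin exprMn mulrA; apply: ler_wpM2r.
    by rewrite exprn_ge0// ltW.
  rewrite (_ : r - _ = r * h); last by ring.
  rewrite (_ : r / _ = r * h * (1 / 2)).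
    by apply: ler_wpM2l => //; rewrite mulr_ge0// ltW.
  by rewrite /h; field; rewrite addrC natr1.
apply: le_measure; rewrite ?inE.
- by apply: measurable_cylinder; exact: measurable_eball.
- exact: measurable_cap_cone.
move=> y [/andP[y0 y1]]; rewrite /eball/= exprMn rho2 => t1.
have y00 : 0 < y 0 0 by apply: lt_le_trans y0; rewrite mulr_gt0//; lra.
have := dot_cons y y; rewrite -expr2 => yE.
have := dot_ge0 (tail_row y) => t0.
rewrite /cap_cone/= dot_pole yE.
have h2 : (1 - h) ^+ 2 <= 1 by rewrite expr_le1//; lra.
have r2 : r ^+ 2 < 1 by rewrite expr_lt1// ltW.
have y2 : y 0 0 ^+ 2 <= r ^+ 2 by rewrite ler_sqr ?nnegrE// ltW.
have y3 : (r * (1 - h)) ^+ 2 <= y 0 0 ^+ 2.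
  by rewrite ler_sqr ?nnegrE ?(ltW y00)// mulr_ge0 ?ltW//; lra.
have t2 : dot (tail_row y) (tail_row y) <= 1 - r ^+ 2.
  by apply: le_trans t1 _; rewrite ler_piMl// subr_ge0 ltW.
split; last split.
- apply/andP; split; last lra.
  by rewrite ltr_pwDl// exprn_gt0.
- exact: ltW.
- rewrite exprMn in y3.
  have : (1 - r ^+ 2) * (r ^+ 2 * (1 - h) ^+ 2) <= (1 - r ^+ 2) * y 0 0 ^+ 2.
    by rewrite ler_wpM2l// subr_ge0 ltW.
  have : r ^+ 2 * dot (tail_row y) (tail_row y) <= r ^+ 2 * ((1 - h) ^+ 2 * (1 - r ^+ 2)).
    by rewrite ler_wpM2l// sqr_ge0.
  lra.
Qed.

End ball.
Arguments eball {R} n rho.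
(** * Double counting *)
Section averaging.
Context {R : realType}.

(** Double counting: the sum of the volumes is the integral of the number of
    sets [K a] that contain a point. *)
Lemma le_sum_volume n (s : seq 'rV[R]_n) (K : 'rV[R]_n -> set 'rV[R]_n)
    (B : set 'rV[R]_n) (c : R) : 0 <= c ->
  (forall a, measurable (K a)) -> measurable B -> {in s, forall a, K a `<=` B} ->
  (forall y, B y -> (count (fun a => y \in K a) s)%:R <= c) ->
  (\sum_(a <- s) volume n (K a) <= c%:E * volume n B)%E.
Proof.
move=> c0 mK mB KB count_le.
have mI (A : set 'rV[R]_n) : measurable A ->
    measurable_fun setT (fun x => (\1_A x)%:E : \bar R).
  by move=> mA; apply/measurable_EFinP; exact: measurable_indic.
rewrite -[in volume n B](setIT B) -integral_indic// -ge0_integralZl//;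
  last exact: mI.
rewrite (eq_bigr (fun a => \int[volume n]_x (\1_(K a) x)%:E)%E); last first.
  by move=> a _; rewrite integral_indic// setIT.
rewrite -ge0_integral_sum//; last by move=> a; exact: mI.
apply: ge0_le_integral => //.
- by move=> x _; apply: sume_ge0.
- by apply: emeasurable_sum => a; exact: mI.
- by apply: measurable_funeM; exact: mI.
move=> x _; rewrite sumEFin -EFinM lee_fin.
rewrite (_ : \sum_(a <- s) _ = (count (fun a => x \in K a) s)%:R); last first.
  by rewrite -sum1_count natr_sum [RHS]big_mkcond; apply: eq_bigr => a _;
    rewrite indicE; case: (_ \in _).
have [Bx|Bx] := pselect (B x); first by rewrite indicE mem_set// mulr1 count_le.
rewrite indicE memNset// mulr0 (@eq_in_count _ _ pred0) ?count_pred0// => a sa /=.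
by apply/negbTE; rewrite notin_setE => /(KB a sa).
Qed.

Lemma count_le1 (T : eqType) (s : seq T) (p : pred T) : uniq s ->
  {in s &, forall a b, p a -> p b -> a = b} -> (count p s <= 1)%N.
Proof.
move=> us h; rewrite -size_filter.
have : {in [seq x <- s | p x] &, forall a b, a = b}.
  by move=> a b; rewrite !mem_filter => /andP[? ?] /andP[? ?]; exact: h.
have := filter_uniq p us; case: [seq x <- s | p x] => [//|a [//|b t]]/=.
move=> /andP[aN _] /(_ a b); rewrite !inE !eqxx orbT => /(_ isT isT) ab.
by rewrite ab !inE eqxx in aN.
Qed.

End averaging.

(** * Spherical codes and their strips *)
Section codes.
Context {R : realType}.

Lemma sphere_dot_bound n (x y : 'rV[R]_n) : sphere n x -> sphere n y ->
  -1 <= dot x y <= 1.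
Proof.
rewrite /sphere/= => x1 y1; have := cauchy_schwarz x y.
by rewrite x1 y1 mulr1 -real_normK ?num_real// expr_le1// ler_norml.
Qed.

Lemma le_angular_distance n theta (x y : 'rV[R]_n) : 0 <= theta <= pi ->
  sphere n x -> sphere n y ->
  (theta <= angular_distance x y) = (dot x y <= cos theta).
Proof.
move=> thetapi xs ys; have xy1 := sphere_dot_bound xs ys.
rewrite /angular_distance !leNgt; congr (~~ _).
have {2}<- : cos (acos (dot x y)) = dot x y by rewrite acosK// in_itv.
by rewrite ltr_cos// in_itv//= acos_ge0// acos_lepi.
Qed.

Lemma dot_sub_sub n (a b : 'rV[R]_n) :
  dot (a - b) (a - b) = dot a a + dot b b - 2 * dot a b.
Proof. by rewrite !dotE (dotC b a); ring. Qed.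

(** Packing: small cubes centred at the points of a code are disjoint and lie in
    a fixed cube. Without such a bound, the supremum [max_code_size] would say
    nothing about an individual code. *)
Lemma spherical_code_bounded n theta : 0 < theta <= pi ->
  exists C : R, forall A : {fset 'rV[R]_n}, spherical_code theta A ->
    #|` A|%:R <= C.
Proof.
move=> /andP[theta0 thetapi].
pose D := 2 - 2 * cos theta.
have D0 : 0 < D.
  rewrite subr_gt0 gtr_pMr// -cos0 ltr_cos// in_itv/= ?lexx ?pi_ge0//.
  by rewrite ltW.
have D4 : D <= 4 by have := cos_geN1 theta; rewrite /D; lra.
(* D bounds from below the squared distance of two points of the code, and two
   overlapping cubes would have centres at squared distance at most
   n (2 delta)^2 < D *)
pose delta : R := D / (4 * n.+1%:R).
have delta0 : 0 < delta by rewrite divr_gt0// mulr_gt0.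
have delta1 : delta <= 1.
  rewrite ler_pdivrMr ?mulr_gt0// mul1r; apply: le_trans D4 _.
  by rewrite ler_peMr// ler1n.
have deltaD : n%:R * (2 * delta) ^+ 2 < D.
  have -> : n%:R * (2 * delta) ^+ 2 = (4 * n.+1%:R * delta - 4 * delta) * delta.
    by rewrite -natr1; ring.
  rewrite (_ : 4 * n.+1%:R * delta = D); last first.
    by rewrite /delta; field; rewrite addrC natr1.
  nra.
exists (((2 * (1 + delta)) ^+ n) / ((2 * delta) ^+ n)) => A cA.
have [As Ad] := cA.
pose K (a : 'rV[R]_n) := [set y | cube n delta (y - a)].
have mK a : measurable (K a).
  apply: (measurable_preimage (f := fun y : 'rV[R]_n => y - a)).
    exact: measurable_rowD.
  exact: measurable_cube.
have vK a : volume n (K a) = ((2 * delta) ^+ n)%:E.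
  by rewrite volume_shift ?volume_cube// ?ltW//; exact: measurable_cube.
have : (\sum_(a <- A) volume n (K a) <= 1%:E * volume n (cube n (1 + delta)))%E.
  apply: le_sum_volume => //; first exact: measurable_cube.
    move=> a aA y /= Kay i.
    have := Kay i; have := coord_le_dot a i; rewrite (As a aA) !mxE => a1 ya.
    have {}a1 : `|a 0 i| <= 1 by rewrite -(@expr_le1 _ 2)// real_normK ?num_real.
    have : `|y 0 i| <= `|y 0 i - a 0 i| + `|a 0 i|.
      by rewrite -{1}(subrK (a 0 i) (y 0 i)); exact: ler_normD.
    by move=> h; apply: le_trans h _; rewrite addrC lerD.
  move=> y _; rewrite (_ : 1 = 1%:R)// ler_nat; apply: count_le1.
    exact: fset_uniq.
  move=> a b aA bA; rewrite !inE => Ka Kb; apply/eqP/negP => /negP ab.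
  have := Ad a b aA bA ab; rewrite le_angular_distance ?(ltW theta0)//; [|exact: As..].
  move=> dab; have := dot_sub_sub a b; rewrite (As a aA) (As b bA) => E.
  have : dot (a - b) (a - b) <= n%:R * (2 * delta) ^+ 2.
    rewrite mulr_natl -[X in _ <= _ *+ X]card_ord -sumr_const; apply: ler_sum => i _.
    rewrite -expr2 -real_normK ?num_real// ler_sqr ?nnegrE ?normr_ge0//;
      last by rewrite mulr_ge0// ltW.
    have := Ka i; have := Kb i; rewrite !mxE => yb ya.
    rewrite (_ : a 0 i - b 0 i = (y 0 i - b 0 i) - (y 0 i - a 0 i)); last by ring.
    have : `|y 0 i - b 0 i - (y 0 i - a 0 i)| <=
        `|y 0 i - b 0 i| + `|y 0 i - a 0 i| by exact: ler_normB.
    by move=> h; apply: le_trans h _; rewrite mulr_natl mulr2n lerD.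
  by rewrite /D in deltaD; lra.
under eq_bigr do rewrite vK.
rewrite volume_cube; last lra.
rewrite sumEFin mul1e lee_fin big_const_seq count_predT iter_addr_0.
have e0 : 0 < (2 * delta) ^+ n by rewrite exprn_gt0// mulr_gt0.
by rewrite ler_pdivlMr// -[X in X <= _ -> _]mulr_natl.
Qed.

Lemma code_size_le_max n theta (A : {fset 'rV[R]_n}) : 0 < theta <= pi ->
  spherical_code theta A -> #|` A|%:R <= max_code_size (R := R) n theta.
Proof.
move=> thetapi cA; apply: ub_le_sup; last by exists A.
have [C h] := spherical_code_bounded n thetapi.
by exists C => _ [B cB <-]; exact: h.
Qed.

Lemma max_code_size_le n theta (C : R) :
  (forall A : {fset 'rV[R]_n}, spherical_code theta A -> #|` A|%:R <= C) ->
  max_code_size n theta <= C.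
Proof.
move=> h; apply: ge_sup; last by move=> _ [A cA <-]; exact: h.
by exists 0, fset0; [split=> ? //; rewrite inE|rewrite cardfs0].
Qed.

(** The geometric heart: projecting the points of the strip orthogonally to [x]
    and normalising gives points of the unit sphere one dimension lower. For
    heights u and v of two points with inner product d, their projections have
    inner product (d - u v) / (sqrt (1 - u^2) sqrt (1 - v^2)), which the
    hypothesis on [u] and [v] bounds by cos theta'. *)
Lemma strip_code_size n theta theta' (lo hi : R) (A : {fset 'rV[R]_n.+1})
    (x : 'rV[R]_n.+1) :
  0 <= theta <= pi -> 0 < theta' <= pi -> 0 <= lo -> hi <= 1 ->
  (forall u v, lo <= u < hi -> lo <= v < hi ->
    cos theta <= u * v +
      cos theta' * (Num.sqrt (1 - u ^+ 2) * Num.sqrt (1 - v ^+ 2))) ->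
  spherical_code theta A -> sphere n.+1 x ->
  (count (fun a => lo <= dot a x < hi) A)%:R <= max_code_size n theta'.
Proof.
move=> thetapi theta'pi lo0 hi1 strip [As Ad] x1.
(* T moves x to the first basis vector, so that the projection orthogonal to x
   becomes the removal of the first coordinate *)
pose T := reflect (x - pole n).
have xT : x = T (pole n) by rewrite /T reflect_swap// dot_pole_pole.
have T0 a : (T a) 0 0 = dot a x.
  by rewrite -dot_pole dot_reflectl -/T -xT.
pose S := [seq a <- A | lo <= dot a x < hi].
pose w (a : 'rV[R]_n.+1) := Num.sqrt (1 - dot a x ^+ 2).
pose p a := (w a)^-1 *: tail_row (T a).
have SA a : a \in S -> a \in A /\ lo <= dot a x < hi.
  by rewrite mem_filter => /andP[].
have w2 a : a \in S -> w a ^+ 2 = 1 - dot a x ^+ 2 /\ 0 < w a.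
  move=> /SA[_ /andP[lou uhi]]; have : 0 < 1 - dot a x ^+ 2.
    by rewrite subr_gt0 expr_lt1//; lra.
  by move=> ?; rewrite sqr_sqrtr ?sqrtr_gt0// ltW.
have dotT a b : dot (tail_row (T a)) (tail_row (T b)) = dot a b - dot a x * dot b x.
  have := dot_cons (T a) (T b); rewrite dot_reflectl reflectK !T0 => ->.
  by rewrite addrAC subrr add0r.
have dot_p a b : dot (p a) (p b) = (dot a b - dot a x * dot b x) / (w a * w b).
  by rewrite !dotE dotT invfM; ring.
have pS a : a \in S -> sphere n (p a).
  move=> aS; have [aA _] := SA a aS; have [wa wa0] := w2 a aS.
  by rewrite /sphere/= dot_p (As a aA) -!expr2 -wa divff// gt_eqF// exprn_gt0.
have pd a b : a \in S -> b \in S -> a != b -> dot (p a) (p b) <= cos theta'.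
  move=> aS bS ab; have [aA ua] := SA a aS; have [bA ub] := SA b bS.
  have [_ wa0] := w2 a aS; have [_ wb0] := w2 b bS.
  rewrite dot_p ler_pdivrMr ?mulr_gt0// lerBlDl.
  apply: le_trans (strip _ _ ua ub).
  by rewrite -le_angular_distance//; [exact: Ad|exact: As..].
have cos'1 : cos theta' < 1.
  have /andP[? ?] := theta'pi.
  by rewrite -cos0 ltr_cos// in_itv/= ?lexx ?pi_ge0// ltW.
have pinj : {in S &, injective p}.
  move=> a b aS bS pab; apply/eqP/negP => /negP ab.
  have := pd a b aS bS ab; rewrite -pab; have := pS a aS; rewrite /sphere/= => ->.
  by rewrite leNgt cos'1.
have : #|` [fset p a | a in S]%fset|%:R <= max_code_size (R := R) n theta'.
  apply: code_size_le_max => //; split.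
    by move=> _ /imfsetP[a/= aS ->]; exact: pS.
  move=> _ _ /imfsetP[a/= aS ->] /imfsetP[b/= bS ->] pab.
  have theta'pi0 : 0 <= theta' <= pi by have /andP[/ltW-> ->] := theta'pi.
  rewrite le_angular_distance//; [|exact: pS..].
  by apply: pd => //; apply: contra_neq pab => ->.
apply: le_trans; rewrite ler_nat -size_filter -/S.
rewrite -(size_map p); apply: uniq_leq_size.
  by rewrite map_inj_in_uniq// filter_uniq// fset_uniq.
by move=> _ /mapP[a aS ->]; apply/imfsetP; exists a.
Qed.

End codes.

(** * Counting a code through its strips *)
Section counting.
Context {R : realType}.

Definition punctured_ball n : set 'rV[R]_n := [set y | 0 < dot y y <= 1].
Arguments punctured_ball : clear implicits.

Lemma measurable_punctured_ball n : measurable (punctured_ball n).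
Proof.
rewrite (_ : punctured_ball n = [set y | 0 < dot y y] `&` [set y | dot y y <= 1]).
  by apply: measurableI; [apply: measurable_lt|apply: measurable_le] => //;
    exact: measurable_dot.
by apply/seteqP; split => y /andP.
Qed.

Lemma cone_sphere n : cone (sphere n : set 'rV[R]_n) = punctured_ball n.
Proof.
apply/seteqP; split => y.
  move=> [t /=]; rewrite in_itv/= => /andP[t0 t1] [a]; rewrite /sphere/= => a1 <-.
  rewrite /punctured_ball/= !dotE a1 mulr1 mulr_gt0//= -expr2 expr_le1// ltW//.
move=> /andP[y0 y1]; exists (Num.sqrt (dot y y)).
  by rewrite /= in_itv/= sqrtr_gt0 y0 -sqrtr1 ler_sqrt.
have s0 : Num.sqrt (dot y y) != 0 by rewrite gt_eqF// sqrtr_gt0.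
exists ((Num.sqrt (dot y y))^-1 *: y); last by rewrite scalerA mulfV// scale1r.
rewrite /sphere/= !dotE mulrA -expr2 exprVn sqr_sqrtr ?(ltW y0)//.
by rewrite mulVf// gt_eqF.
Qed.

Lemma cone_spherical_cap n rho (z : 'rV[R]_n) :
  cone (spherical_cap rho z) = cap_cone (Num.sqrt (1 - rho ^+ 2)) z.
Proof.
set r := Num.sqrt _; have r0 : 0 <= r by exact: sqrtr_ge0.
apply/seteqP; split => y.
  move=> [t /=]; rewrite in_itv/= => /andP[t0 t1] [a [a1 raz]] <-.
  rewrite /sphere/= in a1; rewrite /cap_cone/= !dotE a1 mulr1.
  have az0 : 0 <= dot a z by exact: le_trans raz.
  split; first by rewrite mulr_gt0//= -expr2 expr_le1// ltW.
  split; first by rewrite mulr_ge0// ltW.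
  by rewrite -expr2 exprMn mulrC ler_pM2l ?exprn_gt0// ler_sqr.
move=> [/andP[y0 y1] [yz0 h]]; exists (Num.sqrt (dot y y)).
  by rewrite /= in_itv/= sqrtr_gt0 y0 -sqrtr1 ler_sqrt.
have s0 : 0 < Num.sqrt (dot y y) by rewrite sqrtr_gt0.
exists ((Num.sqrt (dot y y))^-1 *: y); last by rewrite scalerA mulfV ?scale1r// gt_eqF.
split.
  rewrite /sphere/= !dotE mulrA -expr2 exprVn sqr_sqrtr ?(ltW y0)//.
  by rewrite mulVf// gt_eqF.
rewrite -/r dotZl ler_pdivlMl//.
rewrite -ler_sqr ?nnegrE//; last by rewrite mulr_ge0// ltW.
by rewrite exprMn sqr_sqrtr ?(ltW y0)// mulrC.
Qed.

Lemma sub_cap_cone n lo hi (z : 'rV[R]_n) : 0 <= lo <= hi ->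
  cap_cone hi z `<=` cap_cone lo z.
Proof.
move=> /andP[lo0 lohi] y [y01 [yz h]]; split => //; split => //.
apply: le_trans h; have /andP[y0 _] := y01.
by rewrite ler_pM2r// ler_sqr// nnegrE (le_trans lo0).
Qed.

Lemma cap_cone_sub_ball n r (z : 'rV[R]_n) :
  cap_cone r z `<=` punctured_ball n.
Proof. by move=> y []. Qed.

Lemma volume_punctured_ball_fin n :
  volume n (punctured_ball n) \is a fin_num.
Proof.
rewrite ge0_fin_numE//; apply: le_lt_trans (_ : volume n (eball n 1) < _)%E.
  apply: le_measure; rewrite ?inE; [exact: measurable_punctured_ball|exact: measurable_eball|].
  by move=> y /andP[_]; rewrite /eball/= expr1n.
by rewrite -ge0_fin_numE// volume_eball_fin.
Qed.

Lemma volume_cap_cone_fin n r (z : 'rV[R]_n) :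
  volume n (cap_cone r z) \is a fin_num.
Proof.
rewrite ge0_fin_numE//; apply: le_lt_trans (_ : volume n (punctured_ball n) < _)%E.
  apply: le_measure; rewrite ?inE.
  - exact: measurable_cap_cone.
  - exact: measurable_punctured_ball.
  - exact: cap_cone_sub_ball.
by rewrite -ge0_fin_numE// volume_punctured_ball_fin.
Qed.

(** Averaging over the directions: a direction in the ball sees at most
    M(n-1, theta') points of the code in its strip, while each point is seen
    from a region whose volume is a difference of two caps, independent of the
    point by invariance under reflections. *)
Lemma code_size_strip_le n theta theta' (lo hi : R) (A : {fset 'rV[R]_n.+1})
    (z : 'rV[R]_n.+1) :
  0 <= theta <= pi -> 0 < theta' <= pi -> 0 <= lo <= hi -> hi <= 1 ->
  (forall u v, lo <= u < hi -> lo <= v < hi ->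
    cos theta <= u * v +
      cos theta' * (Num.sqrt (1 - u ^+ 2) * Num.sqrt (1 - v ^+ 2))) ->
  spherical_code theta A -> sphere n.+1 z ->
  #|` A|%:R * (fine (volume n.+1 (cap_cone lo z)) -
               fine (volume n.+1 (cap_cone hi z))) <=
  max_code_size n theta' * fine (volume n.+1 (punctured_ball n.+1)).
Proof.
move=> thetapi theta'pi /andP[lo0 lohi] hi1 strip cA z1.
pose K (a : 'rV[R]_n.+1) := cap_cone lo a `\` cap_cone hi a.
have mK a : measurable (K a) by apply: measurableD; exact: measurable_cap_cone.
have vK (a : 'rV[R]_n.+1) : a \in A -> volume n.+1 (K a) =
    (fine (volume n.+1 (cap_cone lo z)) - fine (volume n.+1 (cap_cone hi z)))%:E.
  move=> aA; have a1 : dot a a = dot z z by rewrite cA.1.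
  have -> : volume n.+1 (K a) =
      (volume n.+1 (cap_cone lo a) - volume n.+1 (cap_cone hi a))%E.
    have KI : cap_cone lo a `&` cap_cone hi a = cap_cone hi a.
      by apply/setIidPr/sub_cap_cone; rewrite lo0.
    rewrite -{1}KI; apply: measureD; try exact: measurable_cap_cone.
    by rewrite -ge0_fin_numE// volume_cap_cone_fin.
  have E r : volume n.+1 (cap_cone r a) = volume n.+1 (cap_cone r z).
    exact: volume_cap_cone_center.
  by rewrite !E EFinB !fineK// volume_cap_cone_fin.
have M0 : 0 <= max_code_size (R := R) n theta'.
  have /code_size_le_max : spherical_code theta' (fset0 : {fset 'rV[R]_n}).
    by split=> ? //; rewrite inE.
  by move=> /(_ theta'pi); rewrite cardfs0.
have : (\sum_(a <- A) volume n.+1 (K a) <=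
    (max_code_size n theta')%:E * volume n.+1 (punctured_ball n.+1))%E.
  apply: le_sum_volume => //; first exact: measurable_punctured_ball.
    by move=> a _ y [/cap_cone_sub_ball].
  move=> y /andP[y0 y1].
  pose x := (Num.sqrt (dot y y))^-1 *: y.
  have s0 : 0 < Num.sqrt (dot y y) by rewrite sqrtr_gt0.
  have s2 : Num.sqrt (dot y y) ^+ 2 = dot y y by rewrite sqr_sqrtr// ltW.
  have x1 : sphere n.+1 x.
    rewrite /sphere/= !dotE mulrA -expr2 exprVn s2.
    by rewrite mulVf// gt_eqF.
  apply: le_trans (strip_code_size thetapi theta'pi lo0 hi1 strip cA x1).
  rewrite ler_nat; apply: sub_count => a /=; rewrite inE => -[[_ [ya h]] h'].
  have -> : dot a x = dot y a / Num.sqrt (dot y y) by rewrite dotZr dotC mulrC.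
  rewrite ler_pdivlMr// ltr_pdivrMr//; apply/andP; split.
    rewrite -ler_sqr ?nnegrE//; last by rewrite mulr_ge0// ltW.
    by rewrite exprMn s2.
  rewrite ltNge; apply/negP => h2; apply: h'; split; first by rewrite y0.
  split => //; rewrite -s2 -exprMn ler_sqr ?nnegrE//.
  by rewrite mulr_ge0 ?(ltW s0)// (le_trans lo0).
rewrite big_seq (eq_bigr _ vK) -big_seq sumEFin.
rewrite -(fineK (volume_punctured_ball_fin n.+1)) -EFinM lee_fin.
by rewrite big_const_seq count_predT iter_addr_0 -[X in X <= _ -> _]mulr_natl.
Qed.

End counting.
Arguments punctured_ball {R} n.
(** * Trigonometry of the strip *)
Section angles.
Context {R : realType}.
Variables (theta theta' : R).
Hypotheses (theta_gt0 : 0 < theta) (theta_lt : theta < theta')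
  (theta'_ltpi : theta' < pi).

Local Notation s := (cos theta).
Local Notation s' := (cos theta').
Local Notation r := (inner_cos theta theta').
Local Notation D := (s - s' + s * s').

Lemma theta_itv : 0 <= theta <= pi.
Proof. by rewrite (ltW theta_gt0) ltW// (lt_trans theta_lt). Qed.

Lemma theta'_itv : 0 < theta' <= pi.
Proof. by rewrite (lt_trans theta_gt0)// ltW. Qed.

Let theta'_itvW : 0 <= theta' <= pi.
Proof. by have /andP[/ltW-> ->] := theta'_itv. Qed.

Lemma cos_lt_cos : s' < s.
Proof. by rewrite ltr_cos// in_itv/= ?theta_itv. Qed.

Lemma cos_theta_lt1 : s < 1.
Proof. by rewrite -cos0 ltr_cos// in_itv/= ?theta_itv// lexx pi_ge0. Qed.

Lemma inner_cos_sqr : r ^+ 2 = (s - s') / (1 - s').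
Proof.
have := cos_lt_cos; have := cos_theta_lt1 => ? ?.
by rewrite sqr_sqrtr// divr_ge0//; lra.
Qed.

Lemma inner_cos_itv : 0 < r < 1.
Proof.
have := cos_lt_cos; have := cos_theta_lt1 => ? ?.
have r0 : 0 < r by rewrite sqrtr_gt0 divr_gt0//; lra.
rewrite r0 -(@expr_lt1 _ 2) ?(ltW r0)// inner_cos_sqr ltr_pdivrMr; lra.
Qed.

Lemma cap_radius_inner_cos :
  Num.sqrt (1 - (sin (theta / 2) / sin (theta' / 2)) ^+ 2) = r.
Proof.
have half (x : R) : sin (x / 2) ^+ 2 = (1 - cos x) / 2.
  rewrite sin2cos2 -{2}(mulfVK (_ : (2 : R) != 0) x)//.
  by rewrite mulr_natr cos_mulr2n -mulr_natr; lra.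
have := cos_lt_cos; have := cos_theta_lt1 => ? ?.
rewrite /inner_cos; congr Num.sqrt.
by rewrite exprMn exprVn !half; field; rewrite subr_eq0 gt_eqF//; lra.
Qed.

Lemma strip_denominator_gt0 : 0 < D.
Proof.
have := cos_lt_cos; have := cos_theta_lt1 => ? ?.
rewrite (_ : D = s ^+ 2 + (1 - s) * (s - s')); last by ring.
by rewrite ltr_wpDl ?sqr_ge0// mulr_gt0//; lra.
Qed.

(** With psi the arctangent and beta the arccosine that occur in the definition,
    [outer_cos] is - cos (2 psi + beta), and the addition formulas make it
    algebraic in s and s'. All further properties are read off this closed
    form. *)
Lemma outer_cosE : outer_cos theta theta' = r * (s + s' - s * s') / D.
Proof.
have := cos_lt_cos; have := cos_theta_lt1 => s1 ss.
have D0 := strip_denominator_gt0; have r2 := inner_cos_sqr; have /andP[r0 r1] := inner_cos_itv.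
have r11 : -1 <= r <= 1 by apply/andP; split; lra.
rewrite /outer_cos /strip_angle.
set P := Num.sqrt ((1 - s) * (s - s')).
have P0 : 0 < P by rewrite sqrtr_gt0 mulr_gt0//; lra.
have P2 : P ^+ 2 = (1 - s) * (s - s').
  by rewrite sqr_sqrtr// mulr_ge0//; lra.
have D_eq : D = P ^+ 2 + s ^+ 2 by rewrite P2; ring.
set psi := atan _.
have c2 : cos psi ^+ 2 = P ^+ 2 / D.
  rewrite cos_atan exprVn sqr_sqrtr; last by rewrite ltW// ltr_pwDl// sqr_ge0.
  rewrite exprMn exprVn D_eq; field.
  by rewrite -D_eq !gt_eqF.
have c0 : cos psi != 0.
  by rewrite -sqrf_eq0 c2 gt_eqF// divr_gt0// exprn_gt0.
have sc : sin psi = s / P * cos psi.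
  by rewrite -[s / P]atanK -/psi /tan mulfVK.
have cosB : cos (2 * psi + acos r - pi) = - cos (2 * psi + acos r).
  by rewrite -[in RHS](subrK pi (2 * psi + acos r)) cosDpi opprK.
rewrite cosB cosD acosK ?in_itv// sin_acos// mulr_natl cos_mulr2n sin_mulr2n sc.
set w := Num.sqrt _.
have Pw : P * w = (1 - s) * r.
  apply/eqP; rewrite -(@eqrXn2 _ 2)//; first last.
  - by rewrite mulr_ge0//; lra.
  - by rewrite mulr_ge0// ?sqrtr_ge0.
  rewrite !exprMn P2 sqr_sqrtr; last by rewrite r2 subr_ge0 ler_pdivrMr; lra.
  by apply/eqP; rewrite r2; field; rewrite subr_eq0 gt_eqF//; lra.
have -> : (cos psi * (s / P * cos psi)) *+ 2 * w = 2 * s * (cos psi ^+ 2 / P ^+ 2) * (P * w).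
  by rewrite -mulr_natl; field; rewrite gt_eqF.
rewrite Pw c2.
have -> : P ^+ 2 / D / P ^+ 2 = D^-1 by field; rewrite gt_eqF//= gt_eqF.
rewrite -mulr_natl P2; field.
by rewrite gt_eqF.
Qed.

(** Hence the sign of R^2 - r^2, and that of the rate, is the sign of
    cos theta * cos theta'. *)
Lemma outer_inner_cos_sqr :
  outer_cos theta theta' ^+ 2 - r ^+ 2 = (r / D) ^+ 2 * (4 * (s * s') * (1 - s)).
Proof. by rewrite outer_cosE; field; rewrite gt_eqF// strip_denominator_gt0. Qed.

Lemma inner_cos_sqr_lt_outer : 0 < s * s' -> r ^+ 2 < outer_cos theta theta' ^+ 2.
Proof.
move=> ss; have /andP[r0 _] := inner_cos_itv.
rewrite -subr_gt0 outer_inner_cos_sqr mulr_gt0//.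
  by rewrite exprn_gt0// divr_gt0// strip_denominator_gt0.
apply: mulr_gt0; first exact: mulr_gt0.
by rewrite subr_gt0 cos_theta_lt1.
Qed.

Lemma inner_cos_lt_outer : 0 < s' -> r < outer_cos theta theta'.
Proof.
move=> s'0; have /andP[r0 _] := inner_cos_itv.
have := cos_lt_cos; have := cos_theta_lt1 => s1 ss.
rewrite outer_cosE ltr_pdivlMr ?strip_denominator_gt0// ltr_pM2l//.
have : s' * s < s' by rewrite gtr_pMr.
lra.
Qed.

(** This is the equation that determines R: as a function of v, the equation
    (s - r v)^2 = s'^2 (1 - r^2) (1 - v^2) is quadratic with roots r and R. *)
Lemma outer_corner_sqr : s' ^+ 2 * ((1 - r ^+ 2) * (1 - outer_cos theta theta' ^+ 2)) =
  (s - r * outer_cos theta theta') ^+ 2.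
Proof.
have := cos_lt_cos; have := cos_theta_lt1 => s1 ss.
rewrite outer_cosE -!mulrA [in RHS]mulrA -expr2 [(r * _) ^+ 2]exprMn.
rewrite inner_cos_sqr; field.
by rewrite !gt_eqF ?subr_gt0 ?strip_denominator_gt0//; lra.
Qed.

End angles.

(** * The inequality that separates projected points *)
Section strip.
Context {R : realType}.

(** A nonnegative combination of a linear function and of the concave function
    u |-> sqrt (1 - u^2) is at least [s] between two points where it is. *)
Lemma concave_arc_ge (k c a b u s : R) : 0 <= c -> -1 <= a -> b <= 1 ->
  a <= u <= b ->
  s <= k * a + c * Num.sqrt (1 - a ^+ 2) ->
  s <= k * b + c * Num.sqrt (1 - b ^+ 2) ->
  s <= k * u + c * Num.sqrt (1 - u ^+ 2).
Proof.
move=> c0 a1 b1 /andP[au ub] ha hb.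
have [ab|ab] := leP b a.
  by rewrite (_ : u = a)//; apply/eqP; rewrite eq_le au (le_trans ub).
set A := Num.sqrt (1 - a ^+ 2) in ha *; set B := Num.sqrt (1 - b ^+ 2) in hb *.
have sq (x : R) : -1 <= x -> x <= 1 -> 0 <= 1 - x ^+ 2.
  by move=> ? ?; rewrite subr_ge0 expr2; nra.
have A2 : A ^+ 2 = 1 - a ^+ 2 by rewrite sqr_sqrtr// sq//; lra.
have B2 : B ^+ 2 = 1 - b ^+ 2 by rewrite sqr_sqrtr// sq//; lra.
have A0 : 0 <= A by exact: sqrtr_ge0.
have B0 : 0 <= B by exact: sqrtr_ge0.
pose l := (u - a) / (b - a).
have ba : 0 < b - a by rewrite subr_gt0.
have l0 : 0 <= l by rewrite divr_ge0 ?subr_ge0// ltW.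
have l1 : l <= 1 by rewrite ler_pdivrMr// mul1r; lra.
have uE : u = (1 - l) * a + l * b.
  by rewrite /l; field; rewrite gt_eqF.
have X0 : 0 <= (1 - l) * A + l * B by rewrite addr_ge0// mulr_ge0//; lra.
have X : (1 - l) * A + l * B <= Num.sqrt (1 - u ^+ 2).
  rewrite -(@ler_pXn2r _ 2) ?nnegrE// ?sqrtr_ge0// sqr_sqrtr; last by apply: sq; lra.
  (* the cross term of the square of the chord: (a, A) and (b, B) are unit
     vectors *)
  have corr : a * b + A * B <= 1.
    have := sqr_ge0 (a - b); have := sqr_ge0 (A - B); nra.
  have -> : 1 - u ^+ 2 = ((1 - l) * A + l * B) ^+ 2 +
      2 * (l * (1 - l)) * (1 - (a * b + A * B)).
    have -> : ((1 - l) * A + l * B) ^+ 2 =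
      (1 - l) ^+ 2 * A ^+ 2 + l ^+ 2 * B ^+ 2 + 2 * (l * (1 - l)) * (A * B) by ring.
    by rewrite A2 B2 {1}uE; ring.
  rewrite lerDl mulr_ge0//; last by rewrite subr_ge0.
  by rewrite mulr_ge0// mulr_ge0// subr_ge0.
have : c * ((1 - l) * A + l * B) <= c * Num.sqrt (1 - u ^+ 2) by rewrite ler_wpM2l.
have l1' : 0 <= 1 - l by rewrite subr_ge0.
have p1 := ler_wpM2l l1' ha; have p2 := ler_wpM2l l0 hb.
rewrite {2}uE; lra.
Qed.

(** For a nonnegative [s'], concavity in each variable reduces the inequality on
    a square to its corners. *)
Lemma strip_concave (s s' lo hi u v : R) : 0 <= s' -> 0 <= lo -> hi <= 1 ->
  s <= lo * lo + s' * (Num.sqrt (1 - lo ^+ 2) * Num.sqrt (1 - lo ^+ 2)) ->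
  s <= lo * hi + s' * (Num.sqrt (1 - lo ^+ 2) * Num.sqrt (1 - hi ^+ 2)) ->
  s <= hi * hi + s' * (Num.sqrt (1 - hi ^+ 2) * Num.sqrt (1 - hi ^+ 2)) ->
  lo <= u <= hi -> lo <= v <= hi ->
  s <= u * v + s' * (Num.sqrt (1 - u ^+ 2) * Num.sqrt (1 - v ^+ 2)).
Proof.
move=> s'0 lo0 hi1 h1 h2 h3 ulh vlh.
have lo1 : -1 <= lo by lra.
have k0 x : 0 <= s' * Num.sqrt x by rewrite mulr_ge0// sqrtr_ge0.
pose G x y := x * y + s' * (Num.sqrt (1 - x ^+ 2) * Num.sqrt (1 - y ^+ 2)).
have GC x y : G x y = G y x by rewrite /G mulrC [in X in _ + X](mulrC (Num.sqrt _)).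
have G_ge x y : s <= G x lo -> s <= G x hi -> lo <= y <= hi -> s <= G x y.
  by rewrite /G !mulrA => ? ? ?; exact: (concave_arc_ge (k0 _) lo1 hi1).
rewrite -/(G u v); apply: (G_ge u v) => //; rewrite GC; apply: (G_ge _ u) => //.
by rewrite GC.
Qed.

(** For a nonpositive [s'], both terms of the right-hand side increase with [u]
    and [v], so that only the corner nearest to the origin matters. *)
Lemma strip_monotone (s s' lo u v : R) : s' <= 0 -> 0 <= lo ->
  s <= lo * lo + s' * (1 - lo ^+ 2) ->
  lo <= u < 1 -> lo <= v < 1 ->
  s <= u * v + s' * (Num.sqrt (1 - u ^+ 2) * Num.sqrt (1 - v ^+ 2)).
Proof.
move=> s'0 lo0 h /andP[u1 u2] /andP[v1 v2].
have h2 : Num.sqrt (1 - u ^+ 2) * Num.sqrt (1 - v ^+ 2) <= 1 - lo ^+ 2.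
  have lo2 : 0 <= 1 - lo ^+ 2 by nra.
  rewrite -[leRHS]sqr_sqrtr// expr2 ler_pM ?sqrtr_ge0// ler_sqrt//; nra.
nra.
Qed.

End strip.
(** * The bound for a fixed dimension *)
Section main_bound.
Context {R : realType}.

Lemma cap_ratioE n theta theta' (z : 'rV[R]_n.+1) :
  0 < theta -> theta < theta' -> theta' < pi ->
  cap_ratio theta theta' z =
  fine (volume n.+1 (cap_cone (inner_cos theta theta') z)) /
  fine (volume n.+1 (punctured_ball n.+1)).
Proof.
move=> theta_gt0 theta_lt theta'_ltpi.
rewrite /cap_ratio /sphere_volume cone_spherical_cap cone_sphere.
rewrite cap_radius_inner_cos// -!volumeE;
  [|exact: measurable_punctured_ball|exact: measurable_cap_cone].
rewrite !fineM ?volume_cap_cone_fin ?volume_punctured_ball_fin//=.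
by rewrite -mulf_div divff// mul1r.
Qed.

(** A bound for the ratio of the volumes of the caps at heights [hi] and [r]. *)
Definition cap_defect (r hi : R) n : R :=
  4 * n%:R / r * (Num.sqrt (1 - hi ^+ 2) / Num.sqrt (1 - r ^+ 2)) ^+ n.-1.

(** The two estimates for cones involve the same ball, one dimension lower,
    whose volume cancels. *)
Lemma volume_cap_cone_ratio n (r hi : R) (z : 'rV[R]_n.+2) :
  0 < r < 1 -> 0 <= hi <= 1 -> sphere n.+2 z ->
  fine (volume n.+2 (cap_cone hi z)) <=
  cap_defect r hi n.+2 * fine (volume n.+2 (cap_cone r z)).
Proof.
move=> r01 hi01 z1; have /andP[r0 r1] := r01.
have zpole : dot z z = dot (pole n.+1 : 'rV[R]__) (pole n.+1).
  by rewrite dot_pole_pole.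
have ub := volume_cap_cone_ub n hi01; have lb := volume_cap_cone_lb n.+1 r01.
rewrite !(volume_cap_cone_center _ zpole).
have {}ub : fine (volume n.+2 (cap_cone hi (pole n.+1))) <=
    Num.sqrt (1 - hi ^+ 2) ^+ n.+1 * fine (volume n.+1 (eball n.+1 1)).
  by rewrite -lee_fin EFinM !fineK ?volume_cap_cone_fin ?volume_eball_fin.
have {}lb : r / (4 * n.+2%:R) * Num.sqrt (1 - r ^+ 2) ^+ n.+1 *
    fine (volume n.+1 (eball n.+1 1)) <= fine (volume n.+2 (cap_cone r (pole n.+1))).
  by rewrite -lee_fin EFinM !fineK ?volume_cap_cone_fin ?volume_eball_fin.
move: ub lb.
set w := fine (volume n.+1 _); set rho := Num.sqrt (1 - r ^+ 2).
set q := Num.sqrt (1 - hi ^+ 2); set V := fine (volume _ (cap_cone hi _));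
  set W := fine (volume _ (cap_cone r _)) => ub lb.
have rho0 : 0 < rho by rewrite sqrtr_gt0 subr_gt0 expr_lt1// ltW.
apply: le_trans ub _.
have c0 : 0 <= cap_defect r hi n.+2.
  by rewrite !mulr_ge0// ?invr_ge0 ?exprn_ge0 ?divr_ge0 ?sqrtr_ge0// ltW.
apply: le_trans (ler_wpM2l c0 lb).
rewrite le_eqVlt; apply/orP; left; apply/eqP.
rewrite /cap_defect -/rho -/q exprMn exprVn /=; field.
by rewrite -natrD pnatr_eq0 /= !gt_eqF// exprn_gt0.
Qed.

Lemma volume_cap_cone_gt0 n r (z : 'rV[R]_n.+1) : 0 < r < 1 -> sphere n.+1 z ->
  0 < fine (volume n.+1 (cap_cone r z)).
Proof.
move=> r01 z1; have /andP[r0 r1] := r01.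
have zpole : dot z z = dot (pole n : 'rV[R]__) (pole n).
  by rewrite dot_pole_pole.
apply: fine_gt0; rewrite -ge0_fin_numE// volume_cap_cone_fin andbT.
rewrite (volume_cap_cone_center _ zpole).
apply: lt_le_trans (volume_cap_cone_lb n r01).
rewrite mule_gt0 ?volume_eball_gt0// lte_fin mulr_gt0 ?divr_gt0 ?mulr_gt0//.
by rewrite exprn_gt0// sqrtr_gt0 subr_gt0 expr_lt1// ltW.
Qed.

(** With N the size of a code and d the bound on the relative volume of the
    cap removed, N (1 - d) is at most the main
    term, and 1 / (1 - d) <= 1 + 2 d because d <= 1/2. *)
Lemma max_code_size_bound n theta theta' (hi : R) (z : 'rV[R]_n.+2) :
  0 < theta -> theta < theta' -> theta' < pi ->
  inner_cos theta theta' <= hi <= 1 ->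
  (forall u v, inner_cos theta theta' <= u < hi ->
    inner_cos theta theta' <= v < hi ->
    cos theta <= u * v +
      cos theta' * (Num.sqrt (1 - u ^+ 2) * Num.sqrt (1 - v ^+ 2))) ->
  sphere n.+2 z -> cap_defect (inner_cos theta theta') hi n.+2 <= 1 / 2 ->
  max_code_size n.+2 theta <= max_code_size n.+1 theta' /
    cap_ratio theta theta' z * (1 + 2 * cap_defect (inner_cos theta theta') hi n.+2).
Proof.
move=> theta_gt0 theta_lt theta'_ltpi /andP[rhi hi1] strip z1.
have r01 := inner_cos_itv theta_gt0 theta_lt theta'_ltpi.
have thetapi := theta_itv theta_gt0 theta_lt theta'_ltpi.
have theta'pi := theta'_itv theta_gt0 theta_lt theta'_ltpi.
set r := inner_cos _ _ in rhi strip r01 *; set d := cap_defect _ _ _ => d12.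
have /andP[r0 r1] := r01.
rewrite cap_ratioE// -/r.
have V0 := volume_cap_cone_gt0 r01 z1.
have rlohi : 0 <= r <= hi by rewrite ltW.
have hi01 : 0 <= hi <= 1 by rewrite hi1 (le_trans _ rhi)// ltW.
have W := volume_cap_cone_ratio r01 hi01 z1; rewrite -/d in W.
have d0 : 0 <= d.
  by rewrite !mulr_ge0// ?invr_ge0 ?exprn_ge0 ?divr_ge0 ?sqrtr_ge0// ltW.
apply: max_code_size_le => A cA.
have := code_size_strip_le thetapi theta'pi rlohi hi1 strip cA z1.
move: W V0; set V := fine (volume _ (cap_cone r z)).
set W := fine (volume _ (cap_cone hi z)); set B := fine (volume _ (punctured_ball _)).
set M := max_code_size _ _; set N : R := #|` A|%:R => W_le V0 main.
have MB : N * V * (1 - d) <= M * B.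
  apply: le_trans main; rewrite -mulrA ler_wpM2l//; lra.
have MB0 : 0 <= M * B by apply: le_trans MB; rewrite !mulr_ge0// ?(ltW V0)//; lra.
rewrite invf_div mulrA mulrAC ler_pdivlMr//.
have : N * V <= N * V * (1 - d) * (1 + 2 * d).
  rewrite -[_ * _ * (1 + _)]mulrA ler_peMr ?mulr_ge0 ?(ltW V0)//; nra.
move=> /le_trans; apply.
by rewrite ler_wpM2r//; lra.
Qed.

End main_bound.

(** * Asymptotics *)
Section asymptotics.
Context {R : realType}.

(** This is n p^n <= 1 + p + ... + p^(n-1), multiplied by 1 - p. *)
Lemma natr_geometric_le n (p : R) : 0 <= p <= 1 ->
  n%:R * p ^+ n * (1 - p) <= 1 - p ^+ n.
Proof.
move=> /andP[p0 p1]; elim: n => [|n IHn]; first by rewrite !mul0r expr0 subrr.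
have e0 : 0 <= p ^+ n.+1 by exact: exprn_ge0.
have e1 : p ^+ n.+1 <= 1 by exact: exprn_ile1.
have := ler_wpM2l p0 IHn.
have : p ^+ n.+1 * (1 - p) <= 1 - p by rewrite ler_piMl// subr_ge0.
by rewrite -natr1 exprS in e0 e1 *; lra.
Qed.

Lemma natr_geometric_small (q C : R) : 0 <= q < 1 -> 0 <= C ->
  \forall n \near \oo, C * (n%:R * q ^+ n.-1) <= 1 / 2.
Proof.
move=> /andP[]; rewrite le_eqVlt => /predU1P[<- _ C0|q0 q1 C0].
  near=> n; have -> : (0 : R) ^+ n.-1 = 0.
    rewrite expr0n; have : (2 <= n)%N by near: n; exact: nbhs_infty_ge.
    by case: (n) => [|[]].
  by rewrite !mulr0 divr_ge0.
(* one half of q^n absorbs the factor n, the other half tends to 0 *)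
pose p := Num.sqrt q.
have p0 : 0 < p by rewrite sqrtr_gt0.
have p2 : p ^+ 2 = q by rewrite sqr_sqrtr// ltW.
have p1 : p < 1 by rewrite -(@expr_lt1 _ 2) ?ltW// p2.
have := @cvg_geometric R (C / (q * (1 - p))) p.
rewrite ger0_norm ?(ltW p0)// => /(_ p1) /cvgr0_norm_le /(_ (1 / 2)) => /(_ _)[|N _ hN].
  by rewrite divr_gt0.
near=> n.
have /hN : (N <= n)%N by near: n; exact: nbhs_infty_ge.
rewrite /geometric/=; move/(le_trans (ler_norm _)); apply: le_trans.
rewrite -mulrA ler_wpM2l// [leRHS]mulrC ler_pdivlMr ?mulr_gt0 ?subr_gt0//.
have n0 : (0 < n)%N by near: n; exact: nbhs_infty_ge.
have -> : n%:R * q ^+ n.-1 * (q * (1 - p)) = p ^+ n * (n%:R * p ^+ n * (1 - p)).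
  transitivity (n%:R * (q ^+ n.-1 * q) * (1 - p)); first by ring.
  by rewrite -exprSr prednK// -p2 -exprM mulnC exprM expr2; ring.
rewrite ler_piMr ?exprn_ge0 ?(ltW p0)//.
apply: le_trans (natr_geometric_le _ _) _; first by rewrite !ltW.
by rewrite gerBl exprn_ge0// ltW.
Unshelve. all: by end_near. Qed.

(** The quotient is +oo when [b] is 1 or -1. *)
Lemma one_sub_sqr_ratio_gt1 (a b : R) : a ^+ 2 < 1 -> a ^+ 2 < b ^+ 2 -> b ^+ 2 <= 1 ->
  (1 < (1 - a ^+ 2)%:E / (1 - b ^+ 2)%:E)%E.
Proof.
move=> a1 ab b1; rewrite inver; case: eqP => [_|/eqP b_neq1].
  by rewrite gt0_muley ?ltry// lte_fin subr_gt0.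
have b0 : 0 < 1 - b ^+ 2 by rewrite lt_neqAle eq_sym b_neq1 subr_ge0.
by rewrite -EFinM lte_fin ltr_pdivlMr// mul1r ltrD2l ltrN2.
Qed.

Lemma decay_rate_gt0 theta theta' : 0 < theta -> theta < theta' -> theta' < pi ->
  0 < cos theta * cos theta' -> (0 < decay_rate theta theta' :> \bar R)%E.
Proof.
move=> theta_gt0 theta_lt theta'_ltpi ss.
have /andP[r0 r1] := inner_cos_itv theta_gt0 theta_lt theta'_ltpi.
rewrite /decay_rate mule_gt0 ?lte_fin// lne_gt0 one_sub_sqr_ratio_gt1//.
- by rewrite expr_lt1// ltW.
- exact: inner_cos_sqr_lt_outer.
- by rewrite cos2sin2 gerBl sqr_ge0.
Qed.

Lemma exp_decayE (theta theta' : R) n :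
  0 < 1 - inner_cos theta theta' ^+ 2 -> 0 < 1 - outer_cos theta theta' ^+ 2 ->
  exp_decay (decay_rate theta theta') n =
  (Num.sqrt (1 - outer_cos theta theta' ^+ 2) /
   Num.sqrt (1 - inner_cos theta theta' ^+ 2)) ^+ n.
Proof.
set a := 1 - inner_cos _ _ ^+ 2; set b := 1 - outer_cos _ _ ^+ 2 => a0 b0.
rewrite /exp_decay /decay_rate -/a -/b inver gt_eqF// -EFinM lne_EFin ?divr_gt0//.
rewrite -!EFinM -EFinN /= -mulrN expRM_natl; congr (_ ^+ n).
apply/eqP; rewrite -(@eqrXn2 _ 2)// ?expR_ge0 ?divr_ge0 ?sqrtr_ge0//; apply/eqP.
rewrite -expRM_natl mulrN mulrA divff// mul1r expRN lnK ?posrE ?divr_gt0//.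
by rewrite exprMn exprVn !sqr_sqrtr ?(ltW a0) ?(ltW b0)// invf_div.
Qed.

End asymptotics.
(** * The strip of the theorem *)
Section admissible_strip.
Context {R : realType}.

(** When cos theta' <= 0 the whole cap is admissible up to its centre, and the
    inner cap to be removed is a null set. *)
Definition strip_end (theta theta' : R) : R :=
  if cos theta' <= 0 then 1 else outer_cos theta theta'.

Lemma strip_end_itv theta theta' : 0 < theta -> theta < theta' -> theta' < pi ->
  inner_cos theta theta' < strip_end theta theta' <= 1.
Proof.
move=> theta_gt0 theta_lt theta'_ltpi; rewrite /strip_end.
have /andP[_ r1] := inner_cos_itv theta_gt0 theta_lt theta'_ltpi.
case: (leP (cos theta') 0) => s'0; first by rewrite r1 lexx.
by rewrite inner_cos_lt_outer// cos_le1.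
Qed.

(** At the corner (r, r) there is equality, by the choice of [r]; at the corner
    (r, R) as well, by the choice of R; the corner (R, R) follows from r <= R. *)
Lemma strip_end_admissible theta theta' u v :
  0 < theta -> theta < theta' -> theta' < pi ->
  inner_cos theta theta' <= u < strip_end theta theta' ->
  inner_cos theta theta' <= v < strip_end theta theta' ->
  cos theta <= u * v +
    cos theta' * (Num.sqrt (1 - u ^+ 2) * Num.sqrt (1 - v ^+ 2)).
Proof.
move=> theta_gt0 theta_lt theta'_ltpi.
have /andP[r0 r1] := inner_cos_itv theta_gt0 theta_lt theta'_ltpi.
have := strip_end_itv theta_gt0 theta_lt theta'_ltpi.
have ss := cos_lt_cos theta_gt0 theta_lt theta'_ltpi.
have s1 := cos_theta_lt1 theta_gt0 theta_lt theta'_ltpi.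
have r2 := inner_cos_sqr theta_gt0 theta_lt theta'_ltpi.
have corner : inner_cos theta theta' ^+ 2 +
    cos theta' * (1 - inner_cos theta theta' ^+ 2) = cos theta.
  by rewrite r2; field; rewrite subr_eq0 gt_eqF//; lra.
rewrite /strip_end; case: (leP (cos theta') 0) => s'0.
  move=> _; apply: strip_monotone => //; first exact: ltW.
  by rewrite -expr2 corner.
set r := inner_cos _ _ in r0 r1 r2 corner *.
have := outer_corner_sqr theta_gt0 theta_lt theta'_ltpi; rewrite -/r.
set k := outer_cos _ _ => cornerk /andP[rk k1] /andP[ru uk] /andP[rv vk].
have r2' : 0 <= 1 - r ^+ 2 by nra.
have k2' : 0 <= 1 - k ^+ 2 by nra.
apply: (@strip_concave _ _ _ r k) => //; rewrite ?ru ?rv ?(ltW uk) ?(ltW vk)//;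
  [exact: ltW|exact: ltW|..].
- by rewrite -!expr2 (sqr_sqrtr r2') corner.
- rewrite -lerBlDl; apply: le_trans (ler_norm _) _.
  rewrite -(@ler_pXn2r _ 2) ?nnegrE// ?mulr_ge0 ?sqrtr_ge0 ?(ltW s'0)//.
  by rewrite real_normK ?num_real// !exprMn (sqr_sqrtr r2') (sqr_sqrtr k2') cornerk.
- rewrite -!expr2 (sqr_sqrtr k2') -corner.
  have : r ^+ 2 <= k ^+ 2 by rewrite ler_sqr ?nnegrE; lra.
  nra.
Qed.

End admissible_strip.

Theorem proposition2p2 (R : realType) (theta theta' : R)
    (theta_gt0 : 0 < theta) (theta_lt : theta < theta')
    (theta'_ltpi : theta' < pi) :
  (exists e : nat -> R,
     e =O_\oo (fun n : nat => n%:R * exp_decay (decay_rate theta theta') n) /\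
     \forall n \near \oo, forall z : 'rV[R]_n, sphere n z ->
       max_code_size n theta <=
         max_code_size n.-1 theta' / cap_ratio theta theta' z * (1 + e n)) /\
  (theta' < pi / 2 \/ pi / 2 < theta -> (0 < decay_rate theta theta')%E).
Proof.
have /andP[r0 r1] := inner_cos_itv theta_gt0 theta_lt theta'_ltpi.
have /andP[rhi hi1] := strip_end_itv theta_gt0 theta_lt theta'_ltpi.
split; last first.
  move=> h; apply: decay_rate_gt0 => //; case: h => h.
    by rewrite mulr_gt0// cos_gt0_pihalf//; lra.
  have neg x : pi / 2 < x -> x < pi -> 0 < - cos x.
    move=> x1 x2; rewrite -(subrK pi x) cosDpi opprK cos_gt0_pihalf//.
    by apply/andP; split; lra.
  rewrite -mulrNN mulr_gt0// neg//; lra.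
set r := inner_cos theta theta' in r0 r1 rhi.
set hi := strip_end theta theta' in rhi hi1.
have r2 : 0 < 1 - r ^+ 2 by nra.
have hi2 : 0 <= 1 - hi ^+ 2 by nra.
pose q := Num.sqrt (1 - hi ^+ 2) / Num.sqrt (1 - r ^+ 2).
have q0 : 0 <= q by rewrite divr_ge0// sqrtr_ge0.
have q1 : q < 1.
  rewrite ltr_pdivrMr ?sqrtr_gt0// mul1r ltr_sqrt// ltrD2l ltrN2.
  by rewrite ltr_sqr ?nnegrE//; lra.
have defectE n : cap_defect r hi n = 4 / r * (n%:R * q ^+ n.-1).
  by rewrite /cap_defect -/q; ring.
exists (fun n => 2 * cap_defect r hi n); split.
  apply/eqO_exP; have [q_eq0|q_neq0] := eqVneq q 0.
    exists 1 => //; near=> n.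
    have -> : cap_defect r hi n = 0.
      have n2 : (2 <= n)%N by near: n; exact: nbhs_infty_ge.
      by rewrite defectE q_eq0 expr0n; move: n2; case: (n) => [|[|k]]//= _; rewrite !mulr0.
    by rewrite mulr0 normr0 mulr_ge0.
  exists (8 / (r * q)); first by rewrite divr_gt0// mulr_gt0// lt_neqAle eq_sym q_neq0.
  near=> n.
  have hiE : hi = outer_cos theta theta'.
    move: q_neq0; rewrite /q /hi /strip_end; case: ifP => // _.
    by rewrite expr1n subrr sqrtr0 mul0r eqxx.
  have hi2' : 0 < 1 - hi ^+ 2.
    by rewrite lt_neqAle hi2 andbT; apply: contra_neq q_neq0 => E; rewrite /q -E sqrtr0 mul0r.
  rewrite exp_decayE -?hiE// -/r -/q defectE.
  have n0 : (0 < n)%N by near: n; exact: nbhs_infty_ge.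
  rewrite !ger0_norm ?mulr_ge0 ?exprn_ge0 ?invr_ge0 ?(ltW r0)//.
  have -> : q ^+ n = q * q ^+ n.-1 by rewrite -exprS prednK.
  rewrite le_eqVlt; apply/orP; left; apply/eqP.
  by field; rewrite q_neq0 gt_eqF.
have q01 : 0 <= q < 1 by rewrite q0.
have c0 : 0 <= 4 / r by rewrite divr_ge0// ltW.
have small := natr_geometric_small q01 c0.
near=> n.
have n2 : (2 <= n)%N by near: n; exact: nbhs_infty_ge.
have : cap_defect r hi n <= 1 / 2 by rewrite defectE; near: n.
move: n2; case: (n) => [|[|m]]//= _ d12 z z1.
apply: max_code_size_bound => //; first by rewrite (ltW rhi).
by move=> u v; exact: strip_end_admissible.
Unshelve. all: by end_near. Qed.
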